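(* Let $V\subset\boldsymbol{R}^n$ be a finite union of (at least one) nonempty $\boldsymbol{R}$-rational polyhedral sets in $\boldsymbol{R}^n$, and let $d=\operatorname{dim}(V)$. Let $K$ be one of $\boldsymbol{T}[\boldsymbol{X}^{\pm}]_n$, $\overline{\boldsymbol{T}[\boldsymbol{X}^{\pm}]}_n$, $\overline{\boldsymbol{T}(\boldsymbol{X})}_n$. For a prime congruence $P$ on $K$, the inclusion $\boldsymbol{E}(V)\subset P$ holds if and only if $P=P(U)$ for a t-admissible matrix $U$ of one of the following forms, with the corresponding conditions: Case 0: $U=\begin{pmatrix}0&\cdots&0\end{pmatrix}$. Case 1: $U=Z(y_1,\dots,y_m)$, where $m\le d$, $y_1,\dots,y_m\in\boldsymbol{R}^n$ are linearly independent, and there exist $\varepsilon_2,\dots,\varepsilon_m>0$ such that $$\operatorname{Cone}\Big\{y_1,\ y_1+\varepsilon_2y_2,\ \dots,\ y_1+\sum_{i=2}^m\varepsilon_iy_i\Big\}\subset\operatorname{rec}(V).$$ Case 2: $U=U(x_1,\dots,x_l;k)$, where $1\le k\le l\le d+1$, $x_1,\dots,x_l\in\boldsymbol{R}^n$, the vectors $x_1,\dots,x_{k-1},x_{k+1},\dots,x_l$ are linearly independent, and there exist $\varepsilon_2,\dots,\varepsilon_{k-1},\varepsilon_{k+1},\dots,\varepsilon_l>0$ and $$z\in\{x_k\}+\operatorname{Cone}\Big\{x_1,\ x_1+\varepsilon_2x_2,\ \dots,\ x_1+\sum_{i=2}^{k-1}\varepsilon_ix_i\Big\}$$ such that $$\Big\{z+\sum_{i=k+1}^l\delta_ix_i\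 \Big|\ 0\le\delta_i\le\varepsilon_i\Big\}+\operatorname{Cone}\Big\{x_1,\ x_1+\varepsilon_2x_2,\ \dots,\ x_1+\sum_{i=2}^{k-1}\varepsilon_ix_i\Big\}\subset V.$$
   Context: Semirings and primes. A congruence on a (commutative, unital, with absorbing zero) semiring $S$ is an equivalence relation $C\subset S\times S$ compatible with addition and multiplication; it is prime if $C\neq S\times S$ and $(a\cdot c+b\cdot d,\ a\cdot d+b\cdot c)\in C$ implies $(a,b)\in C$ or $(c,d)\in C$. $\boldsymbol{T}=\boldsymbol{R}\cup\{-\infty\}$ is the tropical semifield ($\oplus=\max$, $\odot=+$). $\boldsymbol{T}[\boldsymbol{X}^{\pm}]_n$ is the semiring of (formal) tropical Laurent polynomials in $n$ variables; $\overline{\boldsymbol{T}[\boldsymbol{X}^{\pm}]}_n$ is its quotient by the congruence of pairs defining the same function on $\boldsymbol{R}^n$ (a cancellative semiring), with quotient map $\pi$; $\overline{\boldsymbol{T}(\boldsymbol{X})}_n$ is the semifield of fractions of the latter, with inclusion $\iota:\overline{\boldsymbol{T}[\boldsymbol{X}^{\pm}]}_n\hookrightarrow\overline{\boldsymbol{T}(\boldsymbol{X})}_n$. $\boldsymbol{E}(V)=\{(f,g)\in K^2\mid f(x)=g(x)\ \forall x\in V\}$. t-admissible matrices. Let $1\le l\le n+1$. An $l\times(n+1)$ real matrix $U$ is t-admissible if (1) its first column is zero or has positive first nonzero entry, and (2) for each $1\le i\le l$ there exist $a\in\boldsymbol{R}$, $\boldsymbol{m}\in\boldsymbol{Z}^n$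 such that the first nonzero entry of $U\begin{pmatrix}a\\ \boldsymbol{m}\end{pmatrix}$ is the $i$th entry. In addition the zero row $\begin{pmatrix}0&\cdots&0\end{pmatrix}$ is regarded as t-admissible. For t-admissible $U$, $P(U)$ is the prime congruence on $\boldsymbol{T}[\boldsymbol{X}^{\pm}]_n$ generated by the pairs $(a_1\odot\boldsymbol{X}^{\odot\boldsymbol{m}_1}\oplus a_2\odot\boldsymbol{X}^{\odot\boldsymbol{m}_2},\ a_1\odot\boldsymbol{X}^{\odot\boldsymbol{m}_1})$ with $a_1,a_2\in\boldsymbol{R}$, $\boldsymbol{m}_1,\boldsymbol{m}_2\in\boldsymbol{Z}^n$ such that $U\begin{pmatrix}a_1-a_2\\ \boldsymbol{m}_1-\boldsymbol{m}_2\end{pmatrix}$ is $\boldsymbol{0}$ or has positive first nonzero entry. Pulling back along $\pi$ and $\iota$ induces bijections $\operatorname{CSpec}(\overline{\boldsymbol{T}(\boldsymbol{X})}_n)\to\operatorname{CSpec}(\overline{\boldsymbol{T}[\boldsymbol{X}^{\pm}]}_n)\to\operatorname{CSpec}(\boldsymbol{T}[\boldsymbol{X}^{\pm}]_n)$ of the sets of prime congruences, and the prime congruences corresponding to $P(U)$ are also denoted $P(U)$. Matrices. For $x_1,\dots,x_l\in\boldsymbol{R}^n$ (as row vectors) and $1\le k\le l$, $U(x_1,\dots,x_l;k)$ is the $l\times(n+1)$ matrix whose $k$th row is $(1,x_k)$ and whose $i$th row is $(0,x_i)$ for $i\ne k$. For $m\ge1$, $Z(y_1,\dots,y_m)$ is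 the $m\times(n+1)$ matrix whose $i$th row is $(0,y_i)$. Polyhedral notions. A polyhedral set in $\boldsymbol{R}^n$ is the solution set of a finite system of linear inequalities; it is $\boldsymbol{R}$-rational if it has the form $\{\boldsymbol{x}\mid A\boldsymbol{x}\ge\boldsymbol{b}\}$ with $A$ a rational matrix and $\boldsymbol{b}$ a real vector. The recession cone of a nonempty $\{\boldsymbol{x}\mid A\boldsymbol{x}\ge\boldsymbol{b}\}$ is $\{\boldsymbol{x}\mid A\boldsymbol{x}\ge\boldsymbol{0}\}$. For a finite union $V$ of nonempty polyhedral sets, $\operatorname{rec}(V)$ is the union of their recession cones and $\dim(V)$ is the maximum of their dimensions (dimension of the affine span); these do not depend on the chosen decomposition. $\operatorname{Cone}\{v_1,\dots,v_r\}=\{\sum t_iv_i\mid t_i\ge0\}$, $\operatorname{Cone}(\varnothing)=\{\boldsymbol{0}\}$ (so in Case 2 with $k=1$ the cones are $\{\boldsymbol{0}\}$ and $z=x_1$); $A+B$ is the Minkowski sum. *)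

(* Defs.v *)
From HB Require Import structures.
From mathcomp Require Import all_boot all_order all_algebra.
From mathcomp Require Import finmap.
From mathcomp Require Import boolp classical_sets reals.
From mathcomp Require Import ring.

Set Implicit Arguments.
Unset Strict Implicit.
Unset Printing Implicit Defensive.

Import Order.TTheory GRing.Theory Num.Theory.
Import quotient.

Local Open Scope classical_set_scope.
Local Open Scope quotient_scope.
Local Open Scope ring_scope.

Section Congruence.
Variable S : comPzSemiRingType.
Implicit Type C : set (S * S).

Definition congruence C : Prop :=
  [/\ (forall a, C (a, a)),
      (forall a b, C (a, b) -> C (b, a)),
      (forall a b c, C (a, b) -> C (b, c) -> C (a, c)),
      (forall a b c d, C (a, b) -> C (c, d) -> C (a + c, b + d)) &
      (forall a b c d, C (a, b) -> C (c, d) -> C (a * c, b * d))].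

Definition prime_congruence C : Prop :=
  [/\ congruence C, C <> setT &
      forall a b c d, C (a * c + b * d, a * d + b * c) ->
        C (a, b) \/ C (c, d)].

Definition generated_congruence (G : set (S * S)) : set (S * S) :=
  smallest congruence G.

Definition cancellative : Prop :=
  (1 : S) <> 0 /\ forall a b c : S, c != 0 -> a * c = b * c -> a = b.

End Congruence.

Definition pullback_congruence (S S' : comPzSemiRingType) (phi : S -> S')
    (C : set (S' * S')) : set (S * S) :=
  [set p | C (phi p.1, phi p.2)].

Section Quotient.
Variables (S : comPzSemiRingType) (C : set (S * S)) (HC : congruence C).

Definition congruence_rel : rel S := fun a b => `[< C (a, b) >].

Fact congruence_rel_refl : reflexive congruence_rel.
Proof. by move=> a; apply/asboolP; case: HC. Qed.

Fact congruence_rel_sym : symmetric congruence_rel.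
Proof.
by case: HC => _ s _ _ _ a b; apply/asboolP/asboolP; apply: s.
Qed.

Fact congruence_rel_trans : transitive congruence_rel.
Proof.
case: HC => _ _ t _ _ b a c /asboolP ab /asboolP bc; apply/asboolP.
exact: t ab bc.
Qed.

Definition congruence_equiv : equiv_rel S :=
  EquivRel congruence_rel congruence_rel_refl congruence_rel_sym
    congruence_rel_trans.

Definition quot_semiring : Type := {eq_quot congruence_equiv}.

HB.instance Definition _ := EqQuotient.on quot_semiring.
HB.instance Definition _ := Choice.on quot_semiring.

Definition quot_proj (a : S) : quot_semiring := \pi_{eq_quot congruence_equiv} a.
Definition quot_repr (q : quot_semiring) : S := repr q.

Lemma quot_projP a b : quot_proj a = quot_proj b <-> C (a, b).
Proof.
split=> [/eqmodP/asboolP//|Cab].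
by apply/eqmodP/asboolP.
Qed.

Lemma quot_reprK q : quot_proj (quot_repr q) = q.
Proof. exact: reprK. Qed.

Lemma quot_repr_proj a : C (quot_repr (quot_proj a), a).
Proof. by apply/quot_projP; rewrite quot_reprK. Qed.

Definition quot_add (p q : quot_semiring) : quot_semiring :=
  quot_proj (quot_repr p + quot_repr q).
Definition quot_mul (p q : quot_semiring) : quot_semiring :=
  quot_proj (quot_repr p * quot_repr q).

Lemma quot_addE a b : quot_add (quot_proj a) (quot_proj b) = quot_proj (a + b).
Proof.
case: HC => _ _ _ cD _; apply/quot_projP.
by apply: cD; apply: quot_repr_proj.
Qed.

Lemma quot_mulE a b : quot_mul (quot_proj a) (quot_proj b) = quot_proj (a * b).
Proof.
case: HC => _ _ _ _ cM; apply/quot_projP.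
by apply: cM; apply: quot_repr_proj.
Qed.

Fact quot_addA : associative quot_add.
Proof.
move=> x y z; rewrite -(quot_reprK x) -(quot_reprK y) -(quot_reprK z).
by rewrite !quot_addE addrA.
Qed.
Fact quot_addC : commutative quot_add.
Proof.
move=> x y; rewrite -(quot_reprK x) -(quot_reprK y).
by rewrite !quot_addE addrC.
Qed.
Fact quot_add0 : left_id (quot_proj 0) quot_add.
Proof. by move=> x; rewrite -(quot_reprK x) quot_addE add0r. Qed.

HB.instance Definition _ :=
  GRing.isNmodule.Build quot_semiring quot_addA quot_addC quot_add0.

Fact quot_mulA : associative quot_mul.
Proof.
move=> x y z; rewrite -(quot_reprK x) -(quot_reprK y) -(quot_reprK z).
by rewrite !quot_mulE mulrA.
Qed.
Fact quot_mulC : commutative quot_mul.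
Proof.
move=> x y; rewrite -(quot_reprK x) -(quot_reprK y).
by rewrite !quot_mulE mulrC.
Qed.
Fact quot_mul1 : left_id (quot_proj 1) quot_mul.
Proof. by move=> x; rewrite -(quot_reprK x) quot_mulE mul1r. Qed.
Fact quot_mulDl : left_distributive quot_mul quot_add.
Proof.
move=> x y z; rewrite -(quot_reprK x) -(quot_reprK y) -(quot_reprK z).
by rewrite !(quot_addE, quot_mulE) mulrDl.
Qed.
Fact quot_mul0 : left_zero (quot_proj 0) quot_mul.
Proof. by move=> x; rewrite -(quot_reprK x) quot_mulE mul0r. Qed.

HB.instance Definition _ :=
  GRing.Nmodule_isComPzSemiRing.Build quot_semiring
    quot_mulA quot_mulC quot_mul1 quot_mulDl quot_mul0.

End Quotient.

Section Fractions.
Variables (S : comPzSemiRingType) (HS : cancellative S).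

Definition fraction : Type := {p : S * S | p.2 != 0}.
HB.instance Definition _ := Choice.on fraction.

Definition numer (p : fraction) : S := (val p).1.
Definition denom (p : fraction) : S := (val p).2.
Definition mk_fraction (a b : S) (hb : b != 0) : fraction :=
  exist (fun p : S * S => p.2 != 0) (a, b) hb.

Lemma denom_neq0 p : denom p != 0.
Proof. exact: (valP p). Qed.

Definition fraction_rel : rel fraction :=
  fun p q => numer p * denom q == numer q * denom p.

Fact fraction_rel_refl : reflexive fraction_rel.
Proof. by move=> p; rewrite /fraction_rel. Qed.
Fact fraction_rel_sym : symmetric fraction_rel.
Proof. by move=> p q; rewrite /fraction_rel eq_sym. Qed.
Fact fraction_rel_trans : transitive fraction_rel.
Proof.
move=> q p r /eqP pq /eqP qr; apply/eqP.
apply: (proj2 HS _ _ (denom q) (denom_neq0 q)).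
by rewrite mulrAC pq mulrAC qr mulrAC.
Qed.

Definition fraction_equiv : equiv_rel fraction :=
  EquivRel fraction_rel fraction_rel_refl fraction_rel_sym fraction_rel_trans.

Definition frac_semifield : Type := {eq_quot fraction_equiv}.
HB.instance Definition _ := EqQuotient.on frac_semifield.
HB.instance Definition _ := Choice.on frac_semifield.

Lemma cancellative_mul_neq0 (b d : S) : b != 0 -> d != 0 -> b * d != 0.
Proof.
move=> b0 d0; apply/eqP => bd0; move/eqP: b0; apply.
by apply: (proj2 HS _ _ d d0); rewrite mul0r.
Qed.

Lemma cancellative_1_neq0 : (1 : S) != 0.
Proof. by apply/eqP; case: HS. Qed.

Definition frac_proj (p : fraction) : frac_semifield :=
  \pi_{eq_quot fraction_equiv} p.
Definition frac_repr (q : frac_semifield) : fraction := repr q.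

Lemma frac_projP p q :
  frac_proj p = frac_proj q <-> numer p * denom q = numer q * denom p.
Proof.
split=> [/eqmodP/eqP//|pq].
by apply/eqmodP/eqP.
Qed.

Lemma frac_reprK q : frac_proj (frac_repr q) = q.
Proof. exact: reprK. Qed.

Lemma frac_repr_proj p :
  numer (frac_repr (frac_proj p)) * denom p =
  numer p * denom (frac_repr (frac_proj p)).
Proof. by apply/frac_projP; rewrite frac_reprK. Qed.

Definition fraction_add (p q : fraction) : fraction :=
  mk_fraction (numer p * denom q + numer q * denom p)
    (cancellative_mul_neq0 (denom_neq0 p) (denom_neq0 q)).
Definition fraction_mul (p q : fraction) : fraction :=
  mk_fraction (numer p * numer q)
    (cancellative_mul_neq0 (denom_neq0 p) (denom_neq0 q)).

Lemma fracE : (forall p q, numer (fraction_add p q) =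
    numer p * denom q + numer q * denom p) *
  (forall p q, denom (fraction_add p q) = denom p * denom q) *
  (forall p q, numer (fraction_mul p q) = numer p * numer q) *
  (forall p q, denom (fraction_mul p q) = denom p * denom q) *
  (forall a b (hb : b != 0), numer (mk_fraction a hb) = a) *
  (forall a b (hb : b != 0), denom (mk_fraction a hb) = b).
Proof. by []. Qed.

Definition frac_add (p q : frac_semifield) : frac_semifield :=
  frac_proj (fraction_add (frac_repr p) (frac_repr q)).
Definition frac_mul (p q : frac_semifield) : frac_semifield :=
  frac_proj (fraction_mul (frac_repr p) (frac_repr q)).
Definition frac_inj (a : S) : frac_semifield :=
  frac_proj (mk_fraction a cancellative_1_neq0).

Lemma frac_addE p q :
  frac_add (frac_proj p) (frac_proj q) = frac_proj (fraction_add p q).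
Proof.
apply/frac_projP.
have := frac_repr_proj p; have := frac_repr_proj q; rewrite !fracE.
move: (frac_repr (frac_proj p)) (frac_repr (frac_proj q)) => p' q' Hq Hp.
transitivity (numer p' * denom p * (denom q' * denom q) +
              numer q' * denom q * (denom p' * denom p)); first by ring.
by rewrite Hp Hq; ring.
Qed.

Lemma frac_mulE p q :
  frac_mul (frac_proj p) (frac_proj q) = frac_proj (fraction_mul p q).
Proof.
apply/frac_projP; rewrite !fracE.
by rewrite mulrACA !frac_repr_proj mulrACA.
Qed.

Fact frac_addA : associative frac_add.
Proof.
move=> x y z; rewrite -(frac_reprK x) -(frac_reprK y) -(frac_reprK z).
rewrite !frac_addE; apply/frac_projP; rewrite !fracE.
by ring.
Qed.

Fact frac_addC : commutative frac_add.
Proof.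
move=> x y; rewrite -(frac_reprK x) -(frac_reprK y).
rewrite !frac_addE; apply/frac_projP; rewrite !fracE.
by rewrite addrC [X in _ * X = _]mulrC.
Qed.

Fact frac_add0 : left_id (frac_inj 0) frac_add.
Proof.
move=> x; rewrite -(frac_reprK x) frac_addE; apply/frac_projP.
by rewrite !fracE mul0r add0r mulr1 mul1r.
Qed.

HB.instance Definition _ :=
  GRing.isNmodule.Build frac_semifield frac_addA frac_addC frac_add0.

Fact frac_mulA : associative frac_mul.
Proof.
move=> x y z; rewrite -(frac_reprK x) -(frac_reprK y) -(frac_reprK z).
by rewrite !frac_mulE; apply/frac_projP; rewrite !fracE !mulrA.
Qed.
Fact frac_mulC : commutative frac_mul.
Proof.
move=> x y; rewrite -(frac_reprK x) -(frac_reprK y).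
rewrite !frac_mulE; apply/frac_projP; rewrite !fracE.
by congr (_ * _); rewrite mulrC.
Qed.
Fact frac_mul1 : left_id (frac_inj 1) frac_mul.
Proof.
move=> x; rewrite -(frac_reprK x) frac_mulE; apply/frac_projP.
by rewrite !fracE !mul1r.
Qed.
Fact frac_mulDl : left_distributive frac_mul frac_add.
Proof.
move=> x y z; rewrite -(frac_reprK x) -(frac_reprK y) -(frac_reprK z).
rewrite !(frac_addE, frac_mulE); apply/frac_projP; rewrite !fracE.
by ring.
Qed.
Fact frac_mul0 : left_zero (frac_inj 0) frac_mul.
Proof.
move=> x; rewrite -(frac_reprK x) frac_mulE; apply/frac_projP.
by rewrite !fracE !mul0r.
Qed.

HB.instance Definition _ :=
  GRing.Nmodule_isComPzSemiRing.Build frac_semifield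
    frac_mulA frac_mulC frac_mul1 frac_mulDl frac_mul0.

End Fractions.

(* [None] is the tropical zero [-oo]. *)
Definition trop (R : realType) : Type := option R.

Section Tropical.
Variable R : realType.

HB.instance Definition _ := Choice.on (trop R).

Definition trop_fin (a : R) : trop R := Some a.

Definition trop_add (a b : trop R) : trop R :=
  match a, b with
  | Some x, Some y => Some (Num.max x y)
  | Some x, None => Some x
  | None, _ => b
  end.

Definition trop_mul (a b : trop R) : trop R :=
  if a is Some x then if b is Some y then Some (x + y) else None else None.

(* Only used with a divisor other than [-oo]. *)
Definition trop_div (a b : trop R) : trop R :=
  if a is Some x then if b is Some y then Some (x - y) else None else None.

Fact trop_addA : associative trop_add.
Proof. by case=> [x|] [y|] [z|] //=; rewrite maxA. Qed.
Fact trop_addC : commutative trop_add.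
Proof. by case=> [x|] [y|] //=; rewrite maxC. Qed.
Fact trop_add0 : left_id None trop_add.
Proof. by []. Qed.

HB.instance Definition _ :=
  GRing.isNmodule.Build (trop R) trop_addA trop_addC trop_add0.

Fact trop_mulA : associative trop_mul.
Proof. by case=> [x|] [y|] [z|] //=; rewrite addrA. Qed.
Fact trop_mulC : commutative trop_mul.
Proof. by case=> [x|] [y|] //=; rewrite addrC. Qed.
Fact trop_mul1 : left_id (trop_fin 0) trop_mul.
Proof. by case=> [x|] //=; rewrite add0r. Qed.
Fact trop_mulDl : left_distributive trop_mul trop_add.
Proof. by case=> [x|] [y|] [z|] //=; rewrite addr_maxl. Qed.
Fact trop_mul0 : left_zero None trop_mul.
Proof. by []. Qed.

HB.instance Definition _ :=
  GRing.Nmodule_isComPzSemiRing.Build (trop R)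
    trop_mulA trop_mulC trop_mul1 trop_mulDl trop_mul0.

End Tropical.

(* Laurent polynomials with coefficients in [S] and exponents in [G], as finitely
   supported functions with the pointwise sum and the convolution product. *)

Section GroupSemiring.
Variables (G : zmodType) (S : comPzSemiRingType).

Definition group_semiring : Type := {fsfun G -> S with 0}.
HB.instance Definition _ := Choice.on group_semiring.

Implicit Types f g h : group_semiring.

Definition gs_coef f (m : G) : S := (f : {fsfun G -> S with 0}) m.
Definition gs_supp f : {fset G} := finsupp (f : {fsfun G -> S with 0}).

Definition gs_monomial (a : S) (m : G) : group_semiring :=
  [fsfun k in [fset m]%fset => a].

Definition gs_add f g : group_semiring :=
  [fsfun m in (gs_supp f `|` gs_supp g)%fset => gs_coef f m + gs_coef g m].

Definition gs_mul f g : group_semiring :=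
  [fsfun m in [fset (u + v)%R | u in gs_supp f, v in gs_supp g]%fset =>
    \sum_(u <- gs_supp f) gs_coef f u * gs_coef g (m - u)].

Lemma gs_ext f g : gs_coef f =1 gs_coef g -> f = g.
Proof. by move=> fg; apply/fsfunP. Qed.

Lemma mem_gs_supp f m : (m \in gs_supp f) = (gs_coef f m != 0).
Proof. by rewrite mem_finsupp. Qed.

Lemma gs_coef0 f m : m \notin gs_supp f -> gs_coef f m = 0.
Proof. exact: fsfun_dflt. Qed.

Lemma gs_monomialE a m k : gs_coef (gs_monomial a m) k = if k == m then a else 0.
Proof. by rewrite /gs_coef fsfunE inE. Qed.

Lemma gs_addE f g m : gs_coef (gs_add f g) m = gs_coef f m + gs_coef g m.
Proof.
rewrite {1}/gs_coef fsfunE inE; case: ifP => // /negbT.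
by rewrite negb_or => /andP[mf mg]; rewrite !gs_coef0// addr0.
Qed.

Lemma gs_sum_supp f (A : {fset G}) (F : G -> S) :
    (gs_supp f `<=` A)%fset ->
  \sum_(u <- gs_supp f) gs_coef f u * F u = \sum_(u <- A) gs_coef f u * F u.
Proof.
move=> fA; apply: big_fset_incl => // u _ uf.
by rewrite gs_coef0// mul0r.
Qed.

Lemma gs_mulE f g m :
  gs_coef (gs_mul f g) m =
  \sum_(u <- gs_supp f) gs_coef f u * gs_coef g (m - u).
Proof.
rewrite {1}/gs_coef fsfunE; case: ifPn => // mfg; symmetry.
rewrite big_seq; apply: big1 => u uf.
rewrite [gs_coef g _]gs_coef0 ?mulr0//; apply: contra mfg => mug.
apply/imfset2P; exists u => //=; exists (m - u) => //.
by rewrite addrC subrK.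
Qed.

Lemma gs_coef_sum_delta g m :
  gs_coef g m = \sum_(v <- gs_supp g) if v == m then gs_coef g v else 0.
Proof.
have [mg|mg] := boolP (m \in gs_supp g).
  rewrite (big_fsetD1 m)//= eqxx big_seq big1 ?addr0 // => v.
  by rewrite !inE => /andP[/negPf-> _].
rewrite gs_coef0// big_seq big1// => v vg.
by case: eqP => // vm; rewrite -vm vg in mg.
Qed.

Lemma gs_mulE2 f g m :
  gs_coef (gs_mul f g) m =
  \sum_(u <- gs_supp f) \sum_(v <- gs_supp g)
    if u + v == m then gs_coef f u * gs_coef g v else 0.
Proof.
rewrite gs_mulE; apply: eq_bigr => u _.
rewrite (gs_coef_sum_delta g (m - u)) mulr_sumr.
apply: eq_bigr => v _; rewrite [u + v]addrC -subr_eq0 -[in RHS]subr_eq0.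
by rewrite opprB addrA; case: ifP => //; rewrite mulr0.
Qed.

Fact gs_addA : associative gs_add.
Proof. by move=> f g h; apply: gs_ext => m; rewrite !gs_addE addrA. Qed.
Fact gs_addC : commutative gs_add.
Proof. by move=> f g; apply: gs_ext => m; rewrite !gs_addE addrC. Qed.
Fact gs_add0 : left_id ([fsfun] : group_semiring) gs_add.
Proof.
by move=> f; apply: gs_ext => m; rewrite gs_addE {1}/gs_coef fsfun0E add0r.
Qed.

HB.instance Definition _ :=
  GRing.isNmodule.Build group_semiring gs_addA gs_addC gs_add0.

Fact gs_mulC : commutative gs_mul.
Proof.
move=> f g; apply: gs_ext => m; rewrite !gs_mulE2 exchange_big /=.
apply: eq_bigr => v _; apply: eq_bigr => u _.
by rewrite [v + u]addrC [gs_coef g v * _]mulrC.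
Qed.

Fact gs_mulA : associative gs_mul.
Proof.
move=> f g h; apply: gs_ext => m.
rewrite [gs_mul g h]gs_mulC [RHS](congr1 (gs_coef^~ m) (gs_mulC _ _)) !gs_mulE.
under eq_bigr => u _ do rewrite gs_mulE mulr_sumr.
under [RHS]eq_bigr => w _ do rewrite gs_mulE mulr_sumr.
rewrite exchange_big /=; apply: eq_bigr => w _; apply: eq_bigr => u _.
by rewrite mulrCA addrAC.
Qed.

Fact gs_mul1 : left_id (gs_monomial 1 0) gs_mul.
Proof.
move=> f; apply: gs_ext => m; rewrite gs_mulE.
rewrite (@gs_sum_supp _ [fset 0]%fset); last first.
  apply/fsubsetP => u; rewrite mem_gs_supp inE.
  by rewrite gs_monomialE; case: (u == 0) => //; rewrite eqxx.
by rewrite big_seq_fset1 gs_monomialE eqxx mul1r subr0.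
Qed.

Fact gs_mulDl : left_distributive gs_mul gs_add.
Proof.
move=> f g h; apply: gs_ext => m; rewrite gs_addE !gs_mulE.
pose A := (gs_supp f `|` gs_supp g `|` gs_supp (gs_add f g))%fset.
rewrite !(@gs_sum_supp _ A); first last.
- by apply/fsubsetP => u uf; rewrite !inE uf ?orbT.
- by apply/fsubsetP => u uf; rewrite !inE uf ?orbT.
- by apply/fsubsetP => u uf; rewrite !inE uf ?orbT.
by rewrite -big_split /=; apply: eq_bigr => u _; rewrite gs_addE mulrDl.
Qed.

Fact gs_mul0 : left_zero ([fsfun] : group_semiring) gs_mul.
Proof.
move=> f; apply: gs_ext => m; rewrite gs_mulE big1 => [|u _].
  by rewrite /gs_coef fsfun0E.
by rewrite {1}/gs_coef fsfun0E mul0r.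
Qed.

HB.instance Definition _ :=
  GRing.Nmodule_isComPzSemiRing.Build group_semiring
    gs_mulA gs_mulC gs_mul1 gs_mulDl gs_mul0.

End GroupSemiring.

Definition laurent (R : realType) (n : nat) : comPzSemiRingType :=
  group_semiring 'rV[int]_n (trop R).

Section Evaluation.
Variables (R : realType) (n : nat).

Definition monomial (a : R) (m : 'rV[int]_n) : laurent R n :=
  gs_monomial (trop_fin a) m.

Definition dot_exp (m : 'rV[int]_n) (x : 'rV[R]_n) : R :=
  \sum_i (m 0 i)%:~R * x 0 i.

Definition laurent_eval (f : laurent R n) (x : 'rV[R]_n) : trop R :=
  \sum_(m <- gs_supp f)
    gs_coef f m * trop_fin (dot_exp m x).

Lemma dot_expD m m' x : dot_exp (m + m') x = dot_exp m x + dot_exp m' x.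
Proof.
rewrite /dot_exp -big_split /=; apply: eq_bigr => i _.
by rewrite mxE intrD mulrDl.
Qed.

Lemma laurent_evalD f g x :
  laurent_eval (f + g) x = laurent_eval f x + laurent_eval g x.
Proof.
rewrite /laurent_eval.
pose A := (gs_supp f `|`
  gs_supp g `|`
  gs_supp (f + g)%R)%fset.
rewrite !(@gs_sum_supp _ _ _ A); first last.
- by apply/fsubsetP => u uf; rewrite !inE uf ?orbT.
- by apply/fsubsetP => u uf; rewrite !inE uf ?orbT.
- by apply/fsubsetP => u uf; rewrite !inE uf ?orbT.
by rewrite -big_split /=; apply: eq_bigr => u _; rewrite gs_addE mulrDl.
Qed.

Lemma laurent_evalM f g x :
  laurent_eval (f * g) x = laurent_eval f x * laurent_eval g x.
Proof.
pose chi m : trop R := trop_fin (dot_exp m x).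
have chiD u v : chi (u + v) = chi u * chi v.
  by rewrite /chi dot_expD.
pose F := gs_supp f.
pose H := gs_supp g.
pose A := ([fset (u + v)%R | u in F, v in H] `|`
  gs_supp (f * g)%R)%fset.
rewrite [LHS](@gs_sum_supp _ _ _ A); last first.
  by apply/fsubsetP => u uf; rewrite !inE uf orbT.
rewrite [RHS]mulr_suml.
under [RHS]eq_bigr => u _ do rewrite mulr_sumr.
under [LHS]eq_bigr => m _.
  rewrite gs_mulE2 mulr_suml.
  under eq_bigr => u _ do rewrite mulr_suml.
  over.
rewrite exchange_big [LHS]big_seq [RHS]big_seq /=; apply: eq_bigr => u uF.
rewrite exchange_big [LHS]big_seq [RHS]big_seq /=; apply: eq_bigr => v vH.
rewrite (big_fsetD1 (u + v)) /=; last first.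
  by rewrite inE; apply/orP; left; apply/imfset2P; exists u => //; exists v.
rewrite eqxx big_seq big1 ?addr0 => [|m]; last first.
  by rewrite !inE eq_sym => /andP[/negPf-> _]; rewrite mul0r.
by rewrite -!/(chi _) chiD mulrACA.
Qed.

Definition agreement (K : Type) (ev : K -> 'rV[R]_n -> trop R)
    (V : set 'rV[R]_n) : set (K * K) :=
  [set p | forall x, V x -> ev p.1 x = ev p.2 x].

Fact laurent_agreement_congruence V :
  congruence (agreement laurent_eval V : set (laurent R n * laurent R n)).
Proof.
split=> //=.
- by move=> f g fg x Vx /=; rewrite fg.
- by move=> f g h fg gh x Vx /=; rewrite fg//= gh.
- by move=> f g f' g' fg fg' x Vx /=; rewrite !laurent_evalD fg// fg'.
- by move=> f g f' g' fg fg' x Vx /=; rewrite !laurent_evalM fg// fg'.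
Qed.

(* The quotient by the congruence of the pairs that define the same function on
   the whole space. *)
Definition laurent_fun : comPzSemiRingType :=
  quot_semiring (laurent_agreement_congruence setT).

Definition laurent_fun_proj : laurent R n -> laurent_fun :=
  quot_proj (laurent_agreement_congruence setT).

(* Independent of the representative: see [laurent_fun_eval_proj]. *)
Definition laurent_fun_eval (q : laurent_fun) : 'rV[R]_n -> trop R :=
  laurent_eval (quot_repr q).

Lemma laurent_fun_eval_proj f : laurent_fun_eval (laurent_fun_proj f) =1 laurent_eval f.
Proof.
by move=> x; exact: (quot_repr_proj (laurent_agreement_congruence setT) f).
Qed.

Lemma laurent_fun_evalM q q' x :
  laurent_fun_eval (q * q') x = laurent_fun_eval q x * laurent_fun_eval q' x.
Proof.
rewrite -(quot_reprK q) -(quot_reprK q').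
rewrite [X in laurent_fun_eval X]quot_mulE.
by rewrite !laurent_fun_eval_proj laurent_evalM.
Qed.

Lemma laurent_eval_neq0 (f : laurent R n) m x :
  gs_coef f m != 0 -> laurent_eval f x != 0.
Proof.
move=> fm; rewrite /laurent_eval (big_fsetD1 m) ?mem_gs_supp//=.
case: (gs_coef f m) fm => // a _.
by rewrite /GRing.add /= /GRing.mul /=; case: (\sum_(_ <- _) _).
Qed.

Lemma laurent_fun_eval_neq0 (q : laurent_fun) x :
  q != 0 -> laurent_fun_eval q x != 0.
Proof.
rewrite -(quot_reprK q); move: (quot_repr q) => h h0.
rewrite laurent_fun_eval_proj.
have [[m hm]|h00] := pselect (exists m, gs_coef h m != 0).
  exact: laurent_eval_neq0 hm.
exfalso; move/eqP: h0; apply; congr quot_proj; apply: gs_ext => m.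
rewrite [RHS]fsfun0E; apply/eqP/negPn/negP => hm.
by apply: h00; exists m.
Qed.

Lemma laurent_fun_cancellative : cancellative laurent_fun.
Proof.
split.
  move=> /quot_projP /(_ 0 I) /=; rewrite [RHS]big1; last first.
    by move=> m _; rewrite /gs_coef fsfun0E mul0r.
  by apply/eqP/(@laurent_eval_neq0 _ 0); rewrite gs_monomialE eqxx.
move=> a b c; rewrite -(quot_reprK a) -(quot_reprK b) -(quot_reprK c).
move: (quot_repr a) (quot_repr b) (quot_repr c) => {a b c} f g h h0.
rewrite -[LHS]/(quot_mul _ _) -[RHS]/(quot_mul _ _) !quot_mulE.
move=> /quot_projP fgh; apply/quot_projP => x _ /=.
have /= := fgh x I; rewrite !laurent_evalM.
have := laurent_fun_eval_neq0 x h0; rewrite laurent_fun_eval_proj.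
case: (laurent_eval h x) => // c _.
case: (laurent_eval f x) => [a|]; case: (laurent_eval g x) => [b|] //=.
by move=> [] /addIr ->.
Qed.

Definition rational_fun : comPzSemiRingType :=
  frac_semifield laurent_fun_cancellative.

Definition rational_fun_inj : laurent_fun -> rational_fun :=
  frac_inj laurent_fun_cancellative.

(* Independent of the representative: see [rational_fun_eval_proj]. *)
Definition rational_fun_eval (q : rational_fun) (x : 'rV[R]_n) : trop R :=
  trop_div (laurent_fun_eval (numer (frac_repr q)) x)
           (laurent_fun_eval (denom (frac_repr q)) x).

Lemma rational_fun_eval_proj (p : fraction laurent_fun) x :
  rational_fun_eval (frac_proj laurent_fun_cancellative p) x =
  trop_div (laurent_fun_eval (numer p) x) (laurent_fun_eval (denom p) x).
Proof.
rewrite /rational_fun_eval.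
have := frac_repr_proj laurent_fun_cancellative p.
move: (frac_repr _) => r /(congr1 (laurent_fun_eval^~ x)).
rewrite !laurent_fun_evalM.
have := laurent_fun_eval_neq0 x (denom_neq0 p).
have := laurent_fun_eval_neq0 x (denom_neq0 r).
move: (laurent_fun_eval (denom r) x) (laurent_fun_eval (denom p) x) => [b|]// [d|]//.
move: (laurent_fun_eval (numer r) x) (laurent_fun_eval (numer p) x) => [a|] [c|]//= _ _.
by move=> [] adcb; congr Some; apply/eqP; rewrite subr_eq addrAC eq_sym subr_eq adcb.
Qed.

Lemma rational_fun_eval_inj (q : laurent_fun) :
  rational_fun_eval (rational_fun_inj q) =1 laurent_fun_eval q.
Proof.
move=> x; rewrite rational_fun_eval_proj.
have -> : laurent_fun_eval 1 x = Some 0.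
  rewrite -[1]/(laurent_fun_proj 1) laurent_fun_eval_proj /laurent_eval.
  rewrite (@gs_sum_supp _ _ _ [fset 0]%fset) => [|]; last first.
    apply/fsubsetP => u; rewrite mem_gs_supp inE gs_monomialE.
    by case: (u == 0).
  rewrite big_seq_fset1 gs_monomialE eqxx mul1r /trop_fin /dot_exp.
  by congr Some; apply: big1 => i _; rewrite mxE mul0r.
by case: (laurent_fun_eval q x) => //= a; rewrite subr0.
Qed.

End Evaluation.

Variant function_semiring := LaurentPoly | LaurentFun | RationalFun.

Definition fs_semiring (R : realType) (n : nat) (k : function_semiring) :
    comPzSemiRingType :=
  match k with
  | LaurentPoly => laurent R n
  | LaurentFun => laurent_fun R n
  | RationalFun => rational_fun R n
  end.

Definition fs_map (R : realType) (n : nat) (k : function_semiring) :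
    laurent R n -> fs_semiring R n k :=
  match k return laurent R n -> fs_semiring R n k with
  | LaurentPoly => id
  | LaurentFun => @laurent_fun_proj R n
  | RationalFun => @rational_fun_inj R n \o @laurent_fun_proj R n
  end.

Definition fs_eval (R : realType) (n : nat) (k : function_semiring) :
    fs_semiring R n k -> 'rV[R]_n -> trop R :=
  match k return fs_semiring R n k -> 'rV[R]_n -> trop R with
  | LaurentPoly => @laurent_eval R n
  | LaurentFun => @laurent_fun_eval R n
  | RationalFun => @rational_fun_eval R n
  end.

Definition congruence_E (R : realType) (n : nat) (k : function_semiring)
    (V : set 'rV[R]_n) : set (fs_semiring R n k * fs_semiring R n k) :=
  agreement (@fs_eval R n k) V.

Section Admissible.
Variables (R : realType) (n : nat).

Definition first_nonzero_at (l : nat) (v : 'cV[R]_l) (i : 'I_l) : Prop :=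
  v i 0 != 0 /\ forall j : 'I_l, (j < i)%N -> v j 0 = 0.

Definition zero_or_first_pos (l : nat) (v : 'cV[R]_l) : Prop :=
  v = 0 \/ exists i, first_nonzero_at v i /\ 0 < v i 0.

Definition exponent_col (a : R) (m : 'rV[int]_n) : 'cV[R]_(1 + n) :=
  col_mx a%:M (map_mx intr m)^T.

Definition t_admissible (l : nat) (U : 'M[R]_(l, 1 + n)) : Prop :=
  (l = 1%N /\ U = 0) \/
  [/\ (1 <= l <= n.+1)%N,
      zero_or_first_pos (lsubmx U) &
      forall i : 'I_l, exists a m, first_nonzero_at (U *m exponent_col a m) i].

Definition congruence_P (l : nat) (U : 'M[R]_(l, 1 + n)) :
    set (laurent R n * laurent R n) :=
  generated_congruence
    [set p | exists a1 a2 m1 m2,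
       zero_or_first_pos (U *m exponent_col (a1 - a2) (m1 - m2)) /\
       p = (monomial a1 m1 + monomial a2 m2, monomial a1 m1)].

(* The prime congruence [C] is the one corresponding to [congruence_P U] under
   the bijection given by pulling back along the canonical map. *)
Definition is_congruence_P (k : function_semiring) (l : nat)
    (U : 'M[R]_(l, 1 + n))
    (C : set (fs_semiring R n k * fs_semiring R n k)) : Prop :=
  pullback_congruence (@fs_map R n k) C = congruence_P U.

(* Row indices start at [0], so [k : 'I_l] stands for the row number [k + 1]. *)
Definition matrix_U (l : nat) (x : 'M[R]_(l, n)) (k : 'I_l) :
    'M[R]_(l, 1 + n) :=
  row_mx (delta_mx k 0) x.

Definition matrix_Z (m : nat) (y : 'M[R]_(m, n)) : 'M[R]_(m, 1 + n) :=
  row_mx 0 y.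

End Admissible.

Section Polyhedra.
Variables (R : realType) (n : nat).

Definition linear_ineqs (p : nat) (A : 'M[R]_(p, n)) (b : 'cV[R]_p) :
    set 'rV[R]_n :=
  [set x | forall i, b i 0 <= (A *m x^T) i 0].

Record rational_polyhedron := RationalPolyhedron {
  ineq_number : nat;
  ineq_matrix : 'M[rat]_(ineq_number, n);
  ineq_bound : 'cV[R]_ineq_number }.

Definition polyhedral_set (Q : rational_polyhedron) : set 'rV[R]_n :=
  linear_ineqs (map_mx ratr (ineq_matrix Q)) (ineq_bound Q).

Definition recession_cone (Q : rational_polyhedron) : set 'rV[R]_n :=
  linear_ineqs (map_mx ratr (ineq_matrix Q)) 0.

Definition affine_span (A : set 'rV[R]_n) : set 'rV[R]_n :=
  [set x | exists s : seq (R * 'rV[R]_n),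
     [/\ (forall p, p \in s -> A p.2),
         \sum_(p <- s) p.1 = 1 &
         x = \sum_(p <- s) p.1 *: p.2]].

Definition is_affine_dim (A : set 'rV[R]_n) (d : nat) : Prop :=
  exists (x0 : 'rV[R]_n) (W : {vspace 'rV[R]_n}),
    affine_span A = [set x0 + w | w in [set w | w \in W]] /\ \dim W = d.

(* Well defined on nonempty sets: see [affine_dimP] and [is_affine_dim_uniq]. *)
Definition affine_dim (A : set 'rV[R]_n) : nat := xget 0%N (is_affine_dim A).

Lemma is_affine_dim_uniq A d d' :
  is_affine_dim A d -> is_affine_dim A d' -> d = d'.
Proof.
move=> [x [W [HW <-]]] [x' [W' [HW' <-]]].
have sub y z (Y Z : {vspace 'rV[R]_n}) :
    [set y + w | w in [set w | w \in Y]] = [set z + w | w in [set w | w \in Z]] ->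
    (Y <= Z)%VS.
  move=> YZ; apply/subvP => w wY.
  have : [set y + w | w in [set w | w \in Y]] (y + w) by exists w.
  have : [set y + w | w in [set w | w \in Y]] y by exists 0; rewrite /= ?mem0v ?addr0.
  rewrite YZ => -[a /= aZ ay] [b /= bZ bw].
  have -> : w = b - a.
    by move: bw; rewrite -ay -addrA => /addrI ->; rewrite addrAC subrr add0r.
  exact: memvB.
have HWW' := etrans (esym HW) HW'.
have : (W <= W')%VS by apply: sub HWW'.
have : (W' <= W)%VS by apply: sub (esym HWW').
by move=> W'W WW'; congr (\dim _); apply/eqP; rewrite eqEsubv WW'.
Qed.

Lemma affine_dimP A : A !=set0 -> is_affine_dim A (affine_dim A).
Proof.
move=> [x0 Ax0]; suff [d Hd] : exists d, is_affine_dim A d by exact: (xgetPex 0%N (ex_intro _ d Hd)).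
pose D := [set w | affine_span A (x0 + w)].
have DZD (c : R) (v w : 'rV[R]_n) : D v -> D w -> D (c *: v + w).
  move=> [s [sA s1 sv]] [t [tA t1 tw]].
  exists ([seq (c * p.1, p.2) | p <- s] ++ t ++ [:: (- c, x0)]); split.
  - move=> p; rewrite !mem_cat => /or3P[/mapP[q qs ->]|/tA//|].
      exact: sA qs.
    by rewrite inE => /eqP ->.
  - rewrite !big_cat big_map big_seq1 /= -mulr_sumr s1 t1 mulr1.
    by rewrite addrCA subrr addr0.
  - rewrite !big_cat big_map big_seq1 /= -tw.
    under eq_bigr => p _ do rewrite -scalerA.
    rewrite -scaler_sumr -sv scalerDr scaleNr.
    by rewrite [_ + c *: v]addrC -addrA [c *: x0 + _]addrC subrK [RHS]addrCA.
have D0 : D 0.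
  exists [:: (1, x0)]; split.
  - by move=> p; rewrite inE => /eqP ->.
  - by rewrite big_seq1.
  - by rewrite big_seq1 scale1r addr0.
pose sub r := `[< exists2 W : {vspace 'rV[R]_n},
  forall w, w \in W -> D w & \dim W = r >].
have exsub : exists r, sub r.
  exists 0%N; apply/asboolP; exists 0%VS; last exact: dimv0.
  by move=> w; rewrite memv0 => /eqP ->.
have subn r : sub r -> (r <= \dim {:'rV[R]_n})%N.
  by move=> /asboolP[W _ <-]; exact/dimvS/subvf.
have [r /asboolP[W WD Wr] rmax] := ex_maxnP exsub subn.
have DW w : D w -> w \in W.
  move=> Dw; apply/negPn/negP => wW.
  suff /rmax : sub (\dim (<[w]> + W)).
    rewrite -Wr leqNgt => /negP; apply.
    rewrite ltn_neqAle dimvS ?addvSr// andbT; apply/negP => /eqP eqd.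
    have /eqP eqW : W == (<[w]> + W)%VS by rewrite eqEdim addvSr -eqd leqnn.
    by move/negP: wW; apply; rewrite eqW memvE addvSl.
  apply/asboolP; exists (<[w]> + W)%VS => // v /memv_addP[_ /vlineP[c ->]].
  by move=> [u uW ->]; apply: DZD => //; exact: WD.
exists r, x0, W; split => //; apply/seteqP; split => [x|_ [w /= /WD Dw <-]//] Ax.
exists (x - x0); last by rewrite addrC subrK.
by apply: DW; rewrite /D /= addrC subrK.
Qed.

End Polyhedra.

Section Conditions.
Variables (R : realType) (n : nat).

Definition cone (I : finType) (v : I -> 'rV[R]_n) : set 'rV[R]_n :=
  [set x | exists t : I -> R, (forall i, 0 <= t i) /\ x = \sum_i t i *: v i].

Definition minkowski_sum (A B : set 'rV[R]_n) : set 'rV[R]_n :=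
  [set a + b | a in A & b in B].

(* The first row plus the combination of the rows number [1] to [j] with
   coefficients [eps]; the value of [eps] at the first row is ignored. *)
Definition flag_vector (l : nat) (x : 'M[R]_(l, n)) (eps : 'I_l -> R)
    (j : nat) : 'rV[R]_n :=
  \sum_(i < l | (i <= j)%N)
    (if i == 0 :> nat then row i x else eps i *: row i x).

Definition flag_cone (l : nat) (x : 'M[R]_(l, n)) (eps : 'I_l -> R) (r : nat) :
    set 'rV[R]_n :=
  cone (fun j : 'I_r => flag_vector x eps j).

Definition case0 (l : nat) (U : 'M[R]_(l, 1 + n)) : Prop :=
  l = 1%N /\ U = 0.

Definition case1 (recV : set 'rV[R]_n) (d : nat) (m : nat)
    (U : 'M[R]_(m, 1 + n)) : Prop :=
  exists y : 'M[R]_(m, n),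
    [/\ U = matrix_Z y, (1 <= m <= d)%N, row_free y &
        exists eps : 'I_m -> R,
          (forall i : 'I_m, (0 < i)%N -> 0 < eps i) /\
          flag_cone y eps m `<=` recV].

Definition case2 (V : set 'rV[R]_n) (d : nat) (l : nat)
    (U : 'M[R]_(l, 1 + n)) : Prop :=
  exists (x : 'M[R]_(l, n)) (k : 'I_l),
    [/\ U = matrix_U x k, (l <= d.+1)%N, row_free (row' k x) &
        exists (eps : 'I_l -> R) (z : 'rV[R]_n),
          [/\ (forall i : 'I_l, (0 < i)%N -> i != k -> 0 < eps i),
              minkowski_sum [set row k x] (flag_cone x eps k) z &
              minkowski_sum
                [set z + \sum_(i < l | (k < i)%N) delta i *: row i x
                  | delta in [set delta : 'I_l -> R |
                      forall i : 'I_l, (k < i)%N -> 0 <= delta i <= eps i]]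
                (flag_cone x eps k) `<=` V]].

End Conditions.

(* Main.v *)
From HB Require Import structures.
Require Import Defs.
From mathcomp Require Import all_boot all_order all_algebra.
From mathcomp Require Import finmap.
From mathcomp Require Import boolp classical_sets reals.
From mathcomp Require Import topology normedtype.
From mathcomp Require Import ring lra.

(** A prime congruence [C] on Laurent polynomials is an order on terms: since
    addition is idempotent, primality forces [f1 + f2] to be congruent to [f1]
    or to [f2], so that the terms [a X^m], that is the elements of [R * Z^n],
    carry a translation-invariant total preorder in which a term is nonnegative
    when it absorbs [1].  Every nonzero polynomial is congruent to its leading
    term, so the order determines [C], and the congruence P(U) is the one whose order
    compares [U (a, m)] lexicographically with zero ([prime_congruence_PE]).

    The hinge of the proof is that the congruence contains E(V) exactly when
    every finite nonempty family of strictly positive terms takes positive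
    values at a common point of [V] ([agreement_realised],
    [realised_agreement]).  If the terms [g_i] have no such point, then the
    polynomials sum of the [- g_i] and the same sum plus [1] agree on [V],
    although [1] is the strict leading term of the second one; conversely a
    point where the leading term of [f] beats all terms of [g] separates [f]
    from [g].  So the theorem becomes a statement about orders on terms.

    From the cases to the order: the coordinates of [U (a, m)], multiplied by
    very unequal weights [t^j], have a sum with the sign of the first nonzero
    coordinate, and the same holds after replacing the rows of [U] by flag
    vectors, a triangular change.  In case 2 the sum is, up to a positive
    factor, the value of the term [(a, m)] at a point of the box plus cone,
    hence of [V] ([case2_realised]); in case 1 it is the product of [m] with a
    recession direction, to be followed far enough from a point of [V]
    ([case1_realised]).

    From the order to the cases: the points of [V] supply finite approximations
    of linear functionals which are nonnegative on positive terms, and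
    compactness of the sphere turns them into one functional; repeating this on
    the kernel produces a matrix [U] row by row ([weak_separation],
    [lex_representation]).  Rationality of the polyhedra makes each of their
    inequalities a term, and some polyhedron [Q i] has only nonnegative
    inequality terms: choosing a strictly negative one for every [i] would give
    a finite family without a common point ([realised_polyhedron]).  Row
    operations that preserve lexicographic signs then normalise the first
    column of [U] and make the images of these finitely many terms nonnegative
    entry by entry ([pivot_matrix], [spread_matrix_nonneg]), except behind a
    positive entry in the row [k] that carries the first column.  Entrywise
    nonnegativity says that the rows may be added freely without leaving [Q i],
    and the exception is what forces the box after [k] to be small
    ([nonneg_case1], [nonneg_case2]).  The same directions bound the number of
    rows by the dimension of [Q i]. *)

Set Implicit Arguments.
Unset Strict Implicit.
Unset Printing Implicit Defensive.

Import Order.TTheory GRing.Theory Num.Theory.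
Import numFieldNormedType.Exports.

Local Open Scope classical_set_scope.
Local Open Scope ring_scope.

(** * Vectors ordered by the sign of their first nonzero entry *)

Section FirstNonzero.
Variable R : realType.

Definition first_pos l (v : 'cV[R]_l) : Prop :=
  exists i, first_nonzero_at v i /\ 0 < v i 0.

Lemma first_nonzero_ex l (v : 'cV[R]_l) : v != 0 -> exists i, first_nonzero_at v i.
Proof.
move=> v0; have [i0 vi0] : exists i, v i 0 != 0.
  apply/existsP; apply: contraNT v0; rewrite negb_exists => /forallP v0.
  by apply/eqP/colP => i; rewrite [RHS]mxE; exact/eqP/negPn/v0.
case: (@arg_minnP _ i0 (fun i => v i 0 != 0) val vi0) => i vi imin.
by exists i; split=> // j ji; apply/eqP; apply: contraTT ji => /imin; rewrite -leqNgt.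
Qed.

Lemma first_nonzero_uniq l (v : 'cV[R]_l) i j :
  first_nonzero_at v i -> first_nonzero_at v j -> i = j.
Proof.
move=> [vi ilt] [vj jlt]; apply: val_inj => /=.
case: (ltngtP i j) => // [/jlt|/ilt] v0.
  by rewrite v0 eqxx in vi.
by rewrite v0 eqxx in vj.
Qed.

Lemma first_nonzeroN l (v : 'cV[R]_l) i :
  first_nonzero_at v i -> first_nonzero_at (- v) i.
Proof.
move=> [vi ilt]; split=> [|j ji]; first by rewrite mxE oppr_eq0.
by rewrite mxE ilt// oppr0.
Qed.

Lemma zero_or_first_posNP l (v : 'cV[R]_l) : ~ zero_or_first_pos (- v) <-> first_pos v.
Proof.
split=> [nv|[i [vi vi0]] [v0|[j [vj vj0]]]].
- have [v0|/first_nonzero_ex [i vi]] := eqVneq v 0.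
    by case: nv; left; rewrite v0 oppr0.
  exists i; split=> //; rewrite ltNge le_eqVlt; apply/negP => /orP[vi0|vi0].
    by case: vi => /negP.
  case: nv; right; exists i; split; first exact: first_nonzeroN.
  by rewrite mxE oppr_gt0.
- by have := vi0; rewrite -[v]opprK v0 oppr0 mxE ltxx.
- have ij := first_nonzero_uniq (first_nonzeroN vi) vj.
  by move: vj0; rewrite -ij mxE oppr_gt0 => /(lt_trans vi0); rewrite ltxx.
Qed.

Lemma zero_or_first_pos_total l (v : 'cV[R]_l) :
  zero_or_first_pos v \/ zero_or_first_pos (- v).
Proof.
case: (pselect (zero_or_first_pos (- v))) => [|/zero_or_first_posNP]; first by right.
by left; right.
Qed.

Lemma zero_or_first_posD l (v w : 'cV[R]_l) :
  zero_or_first_pos v -> zero_or_first_pos w -> zero_or_first_pos (v + w).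
Proof.
move=> [->|[i [[vi ilt] vi0]]]; first by rewrite add0r.
move=> [->|[j [[wj jlt] wj0]]]; first by rewrite addr0; right; exists i.
right; case: (ltngtP i j) => ij.
- exists i; rewrite /first_nonzero_at mxE jlt// addr0; split=> //; split=> // h hi.
  by rewrite mxE ilt// jlt ?addr0//; exact: ltn_trans ij.
- exists j; rewrite /first_nonzero_at mxE ilt// add0r; split=> //; split=> // h hj.
  by rewrite mxE jlt// ilt ?addr0//; exact: ltn_trans ij.
- have {ij}ij : i = j by exact: val_inj.
  subst j; have vw : 0 < v i 0 + w i 0 by exact: addr_gt0.
  exists i; rewrite /first_nonzero_at mxE (gt_eqF vw); split=> //; split=> // h hi.
  by rewrite mxE ilt// jlt ?addr0.
Qed.

Lemma first_nonzero_col_mxl l (v : 'cV[R]_l) (c : 'cV[R]_1) i :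
  first_nonzero_at v i -> first_nonzero_at (col_mx v c) (lshift 1 i).
Proof.
move=> [vi ilt]; split=> [|j]; first by rewrite col_mxEu.
case: (split_ordP j) => h -> hi; first by rewrite col_mxEu ilt.
by move: hi; rewrite /= ltnNge ltnW// ltn_addr.
Qed.

Lemma first_nonzero_col_mxr l (v : 'cV[R]_l) (c : 'cV[R]_1) :
  v = 0 -> c 0 0 != 0 -> first_nonzero_at (col_mx v c) (rshift l ord0).
Proof.
move=> v0 c0; split=> [|j]; first by rewrite col_mxEd.
case: (split_ordP j) => h -> hi; first by rewrite col_mxEu v0 mxE.
by move: hi; rewrite /= ltn_add2l.
Qed.

(** The effect on a vector of a lower triangular matrix with positive diagonal.
    Stating it one vector at a time also covers row changes whose coefficients
    are inconvenient to write down as a matrix. *)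
Definition triangular_change l (v v' : 'cV[R]_l) : Prop :=
  forall j : 'I_l, (forall i : 'I_l, (i < j)%N -> v i 0 = 0) ->
    exists2 c, 0 < c & v' j 0 = c * v j 0.

Lemma triangular_first_nonzero l (v v' : 'cV[R]_l) i :
  triangular_change v v' -> first_nonzero_at v i ->
  first_nonzero_at v' i /\ (0 < v i 0 -> 0 < v' i 0).
Proof.
move=> vv' [vi ilt]; have [c c0 v'i] := vv' i ilt; split; last first.
  by rewrite v'i => ?; exact: mulr_gt0.
split=> [|j ji]; first by rewrite v'i mulf_neq0 ?(gt_eqF c0).
have [|d _ ->] := vv' j; first by move=> h hj; exact: (ilt _ (ltn_trans hj ji)).
by rewrite ilt// mulr0.
Qed.

Lemma triangular_first_pos l (v v' : 'cV[R]_l) :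
  triangular_change v v' -> first_pos v -> first_pos v'.
Proof.
move=> vv' [i [vi vi0]]; exists i.
by have [v'i v'i0] := triangular_first_nonzero vv' vi; split => //; exact: v'i0.
Qed.

Lemma triangular_zero_or_first_pos l (v v' : 'cV[R]_l) :
  triangular_change v v' -> zero_or_first_pos v <-> zero_or_first_pos v'.
Proof.
move=> vv'; split=> [[v0|/(triangular_first_pos vv')]|zv'].
- left; apply/colP => j; rewrite [RHS]mxE.
  have [|c _ ->] := vv' j; first by move=> i _; rewrite v0 mxE.
  by rewrite v0 mxE mulr0.
- by right.
apply: contrapT; rewrite -[v]opprK => /zero_or_first_posNP nv.
have: first_pos (- v').
  apply: triangular_first_pos nv => j vlt.
  have [|c c0 v'j] := vv' j; first move=> i ij.
    by have := vlt i ij; rewrite mxE => /eqP; rewrite oppr_eq0 => /eqP.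
  by exists c; rewrite // mxE v'j mxE mulrN.
by move=> /zero_or_first_posNP; rewrite opprK.
Qed.

(** In a vanishing combination of the rows, the last row with a nonzero
    coefficient is tested by the vector on which it is the first nonzero one. *)
Lemma first_nonzero_row_free l s (U : 'M[R]_(l, s)) :
  (forall i, exists v, first_nonzero_at (U *m v) i) -> row_free U.
Proof.
move=> Urows; apply: inj_row_free => a aU; apply/eqP/negPn/negP => a0.
have [i0 ai0] : exists i, a 0 i != 0.
  apply/existsP; apply: contraNT a0; rewrite negb_exists => /forallP a0.
  by apply/eqP/rowP => i; rewrite [RHS]mxE; exact/eqP/negPn/a0.
case: (@arg_maxnP _ i0 (fun i => a 0 i != 0) val ai0) => i ai imax.
have [v [vi ilt]] := Urows i.
have : (a *m U *m v) 0 0 = 0 by rewrite aU mul0mx mxE.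
rewrite -mulmxA mxE (bigD1 i)//= big1 ?addr0 => [|j ji].
  by move/eqP; rewrite mulf_eq0 (negPf ai) (negPf vi).
case: (ltngtP j i) => [/ilt->|ij|/val_inj/eqP]; rewrite ?mulr0//; last by rewrite (negPf ji).
have [->|aj] := eqVneq (a 0 j) 0; first by rewrite mul0r.
by have := imax j aj; rewrite /= leqNgt ij.
Qed.

Definition eventually_small (A : R -> Prop) : Prop :=
  exists2 t0, 0 < t0 & forall t, 0 < t -> t <= t0 -> A t.

Lemma eventually_smallW (A B : R -> Prop) :
  (forall t, 0 < t -> A t -> B t) -> eventually_small A -> eventually_small B.
Proof. by move=> AB [t0 t00 At]; exists t0 => // t tpos tle; apply/AB/At. Qed.

Lemma eventually_small_and (A B : R -> Prop) :
  eventually_small A -> eventually_small B -> eventually_small (fun t => A t /\ B t).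
Proof.
move=> [t0 t00 At] [t1 t10 Bt]; exists (Num.min t0 t1); first by rewrite lt_min t00.
by move=> t tpos; rewrite le_min => /andP[tt0 tt1]; split; [exact: At | exact: Bt].
Qed.

Lemma eventually_small_all (T : eqType) (s : seq T) (A : T -> R -> Prop) :
  (forall x, x \in s -> eventually_small (A x)) ->
  eventually_small (fun t => forall x, x \in s -> A x t).
Proof.
elim: s => [_|x s IH As]; first by exists 1.
have As' : forall y, y \in s -> eventually_small (A y).
  by move=> y ys; apply: As; rewrite inE ys orbT.
apply: eventually_smallW (eventually_small_and (As x (mem_head _ _)) (IH As')).
by move=> t _ [Ax Ast] y; rewrite inE => /orP[/eqP->//|]; exact: Ast.
Qed.

Lemma eventually_small_forall (T : finType) (A : T -> R -> Prop) :
  (forall x, eventually_small (A x)) -> eventually_small (fun t => forall x, A x t).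
Proof.
move=> As; have := @eventually_small_all _ (enum T) A (fun x _ => As x).
by apply: eventually_smallW => t _ Ast x; apply: Ast; rewrite mem_enum.
Qed.

Lemma eventually_small_ex (A : R -> Prop) :
  eventually_small A -> exists2 t, 0 < t & A t.
Proof. by move=> [t t0 At]; exists t => //; exact: At. Qed.

Lemma eventually_small_le (c : R) : 0 < c -> eventually_small (fun t => t <= c).
Proof. by move=> c0; exists c. Qed.

(** Weights [t^i] with [t] small make each entry dominate all later ones. *)
Lemma first_pos_eventually l (v : 'cV[R]_l) :
  first_pos v -> eventually_small (fun t => 0 < \sum_(i < l) t ^+ i * v i 0).
Proof.
move=> [i [[_ ilt] vi0]]; pose M := 1 + \sum_j `|v j 0|.
have M0 : 0 < M by rewrite ltr_pwDl// sumr_ge0.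
have ev1 : eventually_small (fun t : R => t <= 1) by exact: eventually_small_le.
have ev2 : eventually_small (fun t : R => t <= v i 0 / (2 * M)).
  by apply: eventually_small_le; rewrite divr_gt0// mulr_gt0.
apply: eventually_smallW (eventually_small_and ev1 ev2) => t t0 [t1].
rewrite ler_pdivlMr ?mulr_gt0// => tM.
have -> : \sum_(j < l) t ^+ j * v j 0 =
    t ^+ i * (v i 0 + \sum_(j < l | j != i) t ^+ (j - i) * v j 0).
  rewrite (bigD1 i)//= mulrDr; congr (_ + _).
  rewrite mulr_sumr; apply: eq_bigr => j ji.
  have [/ilt->|ij] := ltnP j i; first by rewrite !mulr0.
  by rewrite mulrA -exprD subnKC.
rewrite mulr_gt0 ?exprn_gt0//.
suff : - (\sum_(j < l | j != i) t ^+ (j - i) * v j 0) <= t * M by nra.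
rewrite -sumrN mulrDr mulr1 mulr_sumr.
apply: (@le_trans _ _ (\sum_(j | j != i) t * `|v j 0|)).
  apply: ler_sum => j ji.
  have [/ilt->|ij] := ltnP j i; first by rewrite normr0 !mulr0 oppr0.
  have ij' : (i < j)%N by rewrite ltn_neqAle ij andbT; apply: contraNneq ji => /val_inj->.
  rewrite -mulrN; apply: (@le_trans _ _ (t ^+ (j - i) * `|v j 0|)).
    by rewrite ler_pM2l ?exprn_gt0// -normrN ler_norm.
  apply: ler_wpM2r => //; rewrite -[leRHS]expr1.
  by apply: ler_wiXn2l; rewrite ?subn_gt0 ?(ltW t0).
rewrite [in leRHS](bigD1 i)//= addrA lerDr.
by rewrite addr_ge0 ?mulr_ge0 ?(ltW t0).
Qed.

End FirstNonzero.

(** * A functional nonnegative on a set of vectors *)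

Lemma maximal_row_free (F : fieldType) s (S : set 'rV[F]_s) :
  exists r (B : 'M[F]_(r, s)), [/\ row_free B, forall i, S (row i B) &
    forall v, S v -> (v <= B)%MS].
Proof.
pose good r := `[< exists2 B : 'M[F]_(r, s),
  row_free B & forall i, S (row i B) >].
have ex_good : exists r, good r.
  by exists 0%N; apply/asboolP; exists 0; [rewrite -row_leq_rank | case].
have good_le r : good r -> (r <= s)%N.
  move=> /asboolP[B]; rewrite -row_leq_rank => /leq_trans + _; apply.
  exact: rank_leq_col.
have [r /asboolP[B Bfree BS] rmax] := ex_maxnP ex_good good_le.
exists r, B; split=> // v Sv; apply/negPn/negP => vB.
suff /rmax : good (r + 1)%N by rewrite addn1 ltnn.
apply/asboolP; exists (col_mx B v).
  rewrite -row_leq_rank -addsmxE addn1.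
  suff : (\rank B < \rank (B + v))%N by rewrite (eqP Bfree).
  rewrite (ltn_leqif (mxrank_leqif_sup (addsmxSl B v))) addsmx_sub submx_refl /=.
  exact: vB.
move=> i; case: (split_ordP i) => j ->; first by rewrite rowKu.
by rewrite rowKd; rewrite (row_id j v).
Qed.

(** A functional [w] matters only through its values on a basis of the span of
    [S] taken in [S]; there the nonnegativity conditions are closed, and
    homogeneity allows values of norm one.  Finitely many conditions are
    satisfiable, so compactness of the unit sphere satisfies all of them at
    once, and norm one keeps the functional from vanishing on the basis. *)
Lemma weak_separation (R : realType) s (S : set 'cV[R]_s) :
    S !=set0 ->
    (forall vs : seq 'cV[R]_s, (forall v, v \in vs -> S v) ->
      exists w : 'rV[R]_s, forall v, v \in vs -> 0 < (w *m v) 0 0) ->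
  exists u : 'rV[R]_s, (forall v, S v -> 0 <= (u *m v) 0 0) /\
    (exists2 v, S v & (u *m v) 0 0 != 0).
Proof.
move=> [v0 Sv0] Spos.
have [r [B [Bfree BS Bspan]]] := maximal_row_free [set v | S v^T].
pose ev (v : 'cV[R]_s) (c : 'rV[R]_r) := (c *m (v^T *m pinvmx B)^T) 0 0.
have evE (w : 'rV[R]_s) v : S v -> ev v (w *m B^T) = (w *m v) 0 0.
  move=> Sv; rewrite /ev -mulmxA -trmx_mul -mulmxA.
  by rewrite mulmxA mulmxKpV ?trmxK //; apply: Bspan; rewrite /= trmxK.
have evC v : continuous (ev v).
  move=> c; rewrite /ev; under eq_fun do rewrite mxE.
  apply: (continuous_big (op := +%R)) => [|i _]; first exact: add_continuous.
  by move=> d; apply: continuousM; [exact: coord_continuous | exact: cst_continuous].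
pose K := [set c : 'rV[R]_r | `|c| = 1].
have Kco : compact K.
  apply: bounded_closed_compact; first by exists 1; split=> // x x1 c /= ->; exact: ltW.
  have /continuous_closedP := @norm_continuous R 'rV[R]_r.
  by move=> /(_ [set x | x = 1]); apply; exact: closed_eq.
have := Kco; rewrite compact_In0.
move=> /(_ 'cV[R]_s S (fun v => K `&` [set c | 0 <= ev v c])) [].
- exists (fun v => [set c | 0 <= ev v c]) => // v _.
  have /continuous_closedP := evC v.
  by move=> /(_ [set x | 0 <= x]); apply; exact: closed_ge.
- move=> D' D'S.
  have [v|w wpos] := Spos (v0 :: D').
    by rewrite inE => /orP[/eqP->//|/D'S]; rewrite inE.
  have w0 : w *m B^T != 0.
    apply/eqP => w0; have := wpos v0 (mem_head _ _).
    by rewrite -evE// w0 /ev mul0mx mxE ltxx.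
  have nw : 0 < `|w *m B^T| by rewrite normr_gt0.
  exists (`|w *m B^T|^-1 *: (w *m B^T)) => v /= vD'; split.
    by rewrite /K /= normrZ normfV normr_id mulVf ?normr_eq0.
  rewrite /ev /= -scalemxAl mxE mulr_ge0 ?invr_ge0 ?normr_ge0//.
  rewrite -/(ev v (w *m B^T)) evE; last by have := D'S _ vD'; rewrite inE.
  by apply/ltW/wpos; rewrite inE vD' orbT.
move=> c cpos; exists (c *m (pinvmx B)^T).
have cE v : (c *m (pinvmx B)^T *m v) 0 0 = ev v c.
  by rewrite /ev (trmx_mul v^T) trmxK mulmxA.
split=> [v Sv|]; first by rewrite cE; have [] := cpos v Sv.
have c0 : c != 0 by rewrite -normr_eq0; have [-> _] := cpos v0 Sv0; rewrite oner_eq0.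
have [i ci] : exists i, c 0 i != 0.
  apply/existsP; apply: contraNT c0; rewrite negb_exists => /forallP c0.
  by apply/eqP/rowP => i; rewrite [RHS]mxE; exact/eqP/negPn/c0.
exists (row i B)^T; first exact: BS.
rewrite cE /ev trmxK -row_mul mulmxVp// row1 trmx_delta.
by rewrite -colE mxE.
Qed.

(** * Total preorders represented by real matrices *)

Lemma multiples_bounded_eq0 (R : realType) (a b : R) :
  (forall m, 0 <= a + b *+ m) -> (forall m, 0 <= a + - b *+ m) -> b = 0.
Proof.
move=> ab ab'; apply/eqP; case: ltgtP => // b0.
- have /archi_boundP : 0 <= a / - b.
    by rewrite divr_ge0 ?oppr_ge0 ?(ltW b0)//; have := ab 0%N; rewrite mulr0n addr0.
  rewrite ltr_pdivrMr ?oppr_gt0//.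
  by have := ab (Num.bound (a / - b)); rewrite -mulr_natl; nra.
- have /archi_boundP : 0 <= a / b.
    by rewrite divr_ge0 ?(ltW b0)//; have := ab 0%N; rewrite mulr0n addr0.
  rewrite ltr_pdivrMr//.
  by have := ab' (Num.bound (a / b)); rewrite -mulr_natl; nra.
Qed.

Section LexRepresentation.
Variables (R : realType) (s : nat) (G : zmodType) (e : {additive G -> 'cV[R]_s}).
Variable N : set G.
Hypothesis Ntotal : forall g, N g \/ N (- g).
Hypothesis ND : forall g h, N g -> N h -> N (g + h).
Hypothesis Npos : forall gs : seq G, gs != [::] ->
  (forall g, g \in gs -> ~ N (- g)) ->
  exists w : 'rV[R]_s, forall g, g \in gs -> 0 < (w *m e g) 0 0.

(** The rows found so far never contradict the preorder, though they may leave
    inequivalent elements undistinguished. *)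
Definition lex_partial l (U : 'M[R]_(l, s)) : Prop :=
  (forall g, N g -> zero_or_first_pos (U *m e g)) /\
  (forall i, exists g, first_nonzero_at (U *m e g) i).

(** The functional separating the positive elements of the kernel of [U] is the
    next row. *)
Lemma lex_partial_extend l (U : 'M[R]_(l, s)) :
  lex_partial U -> (exists g, U *m e g = 0 /\ ~ N (- g)) ->
  exists u : 'rV[R]_s, lex_partial (col_mx U u).
Proof.
move=> [UN Urows] [g0 [Ug0 Ng0]].
pose H := [set g | U *m e g = 0 /\ ~ N (- g)].
have [|vs vsH|u [u_ge0 [_ [g1 [Ug1 _] <-] u_neq0]]] := @weak_separation R s (e @` H).
- by exists (e g0), g0.
- have [gs gsH ->] : exists2 gs, (forall g, g \in gs -> H g) & vs = map e gs.
    elim: vs vsH => [|v vs IH] vsH; first by exists [::].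
    have [gs gsH ->] : exists2 gs, (forall g, g \in gs -> H g) & vs = map e gs.
      by apply: IH => v' v's; apply: vsH; rewrite inE v's orbT.
    have [g Hg <-] := vsH v (mem_head _ _).
    by exists (g :: gs) => // h; rewrite inE => /orP[/eqP->//|]; exact: gsH.
  have [->|gs0] := eqVneq gs [::]; first by exists 0.
  have [g /gsH[]//|w wpos] := Npos gs0.
  by exists w => _ /mapP[g /wpos gw ->].
exists u; split=> [g Ng|i]; last first.
  case: (split_ordP i) => j ->.
    by have [g gj] := Urows j; exists g; rewrite mul_col_mx; exact: first_nonzero_col_mxl.
  exists g1; rewrite mul_col_mx; rewrite (ord1 j).
  exact: first_nonzero_col_mxr.
rewrite mul_col_mx.
have [Ug|[i [Ugi ipos]]] := UN g Ng; last first.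
  by right; exists (lshift 1 i); rewrite col_mxEu; split=> //; exact: first_nonzero_col_mxl.
have [Ng'|Ng'] := pselect (N (- g)); last first.
  have := u_ge0 (e g) (ex_intro2 _ _ g (conj Ug Ng') erefl).
  rewrite le_eqVlt => /orP[/eqP u0|u0]; last first.
    right; exists (rshift l ord0); rewrite col_mxEd; split=> //.
    by apply: first_nonzero_col_mxr => //; rewrite gt_eqF.
  left; rewrite Ug; apply/colP => i; rewrite [RHS]mxE.
  case: (split_ordP i) => j ->; first by rewrite col_mxEu mxE.
  by rewrite col_mxEd (ord1 j) -u0.
(* An element equivalent to zero may be added any number of times to [g0]
   without leaving the positive elements. *)
have NMn h m : N h -> N (h *+ m.+1).
  by move=> Nh; elim: m => [|m IH]; rewrite // mulrS; apply: ND.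
have Hmul h m : U *m e h = 0 -> N h -> N (- h) -> H (g0 + h *+ m).
  move=> Uh Nh Nh'; split.
    by rewrite raddfD raddfMn mulmxDr Ug0 add0r -scaler_nat -scalemxAr Uh scaler0.
  case: m => [|m]; first by rewrite mulr0n addr0.
  move=> Ngh; apply: Ng0.
  have -> : - g0 = - (g0 + h *+ m.+1) + h *+ m.+1 by rewrite opprD addrNK.
  by apply: ND => //; exact: NMn.
left; rewrite Ug; apply/colP => i; rewrite [RHS]mxE.
case: (split_ordP i) => j ->; first by rewrite col_mxEu mxE.
rewrite col_mxEd (ord1 j).
have uD h m : (u *m e (g0 + h *+ m)) 0 0 = (u *m e g0) 0 0 + (u *m e h) 0 0 *+ m.
  by rewrite raddfD raddfMn mulmxDr -scaler_nat -scalemxAr !mxE mulr_natl.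
apply: (@multiples_bounded_eq0 R ((u *m e g0) 0 0)) => m.
  by rewrite -uD; apply: u_ge0; exists (g0 + g *+ m) => //; exact: Hmul.
have -> : - (u *m e g) 0 0 *+ m = (u *m e (- g)) 0 0 *+ m.
  by rewrite raddfN mulmxN [in RHS]mxE.
rewrite -uD; apply: u_ge0; exists (g0 + (- g) *+ m) => //.
by apply: Hmul; rewrite ?opprK// raddfN mulmxN Ug oppr0.
Qed.

(** Rows are added as long as some positive element is sent to zero.  Each new
    row is the first nonzero one somewhere, so the rows stay linearly
    independent and the process stops after at most [s] steps. *)
Lemma lex_representation :
  exists l (U : 'M[R]_(l, s)),
    (forall g, N g <-> zero_or_first_pos (U *m e g)) /\
    (forall i, exists g, first_nonzero_at (U *m e g) i).
Proof.
suff extend k : forall l (U : 'M[R]_(l, s)), lex_partial U -> (s <= l + k)%N ->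
    exists l' (U' : 'M[R]_(l', s)), lex_partial U' /\
      ~ exists g, U' *m e g = 0 /\ ~ N (- g).
  have [||l [U [[UN Urows] Umax]]] := extend s 0%N 0 => //.
    by split=> [g _|[]//]; left; rewrite mul0mx; apply/colP => -[].
  exists l, U; split=> // g; split=> [|Ug]; first exact: UN.
  have [//|Ng] := Ntotal g; apply: contrapT => Ng'.
  case: Ug => [Ug|/zero_or_first_posNP].
    by apply: Umax; exists (- g); rewrite raddfN mulmxN Ug oppr0 opprK.
  by apply; have := UN _ Ng; rewrite raddfN mulmxN.
elim: k => [|k IH] l U Upart sl.
  exists l, U; split=> // /(lex_partial_extend Upart) [u [_ urows]].
  have := rank_leq_col (col_mx U u).
  have -> : \rank (col_mx U u) = (l + 1)%N.
    apply/eqP/first_nonzero_row_free => i.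
    by have [g gi] := urows i; exists (e g).
  by rewrite leqNgt addn1 ltnS -(addn0 l) sl.
have [/(lex_partial_extend Upart) [u Upart']|] := pselect (exists g, U *m e g = 0 /\ ~ N (- g)).
  by apply: IH Upart' _; rewrite -addnA add1n.
by move=> Umax; exists l, U.
Qed.

End LexRepresentation.

(** * Laurent polynomials as sums of terms, and congruences as orders on terms *)

Section LaurentTerms.
Variables (R : realType) (n : nat).

Definition term : Type := (R * 'rV[int]_n)%type.
HB.instance Definition _ := GRing.Zmodule.on term.

Implicit Types (g h : term) (f : laurent R n) (p : 'rV[R]_n).

Definition mon g : laurent R n := monomial g.1 g.2.
Definition term_eval g p : R := g.1 + dot_exp g.2 p.
Definition term_col g : 'cV[R]_(1 + n) := exponent_col g.1 g.2.

Fact term_col_is_zmod_morphism : zmod_morphism term_col.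
Proof.
move=> g h; apply/colP => i; rewrite !mxE.
by case: fintype.split => j; rewrite !mxE ?mulrnBl// intrB.
Qed.
HB.instance Definition _ :=
  GRing.isZmodMorphism.Build term 'cV[R]_(1 + n) term_col term_col_is_zmod_morphism.

Lemma mon_coef g m : gs_coef (mon g) m = if m == g.2 then Some g.1 else None.
Proof. exact: gs_monomialE. Qed.

Lemma mon0 : mon 0 = 1.
Proof. by []. Qed.

Lemma monM g h : mon g * mon h = mon (g + h).
Proof.
apply: gs_ext => m; rewrite -[LHS]/(gs_coef (gs_mul _ _) m) gs_mulE.
rewrite (@gs_sum_supp _ _ _ [fset g.2]%fset); last first.
  by apply/fsubsetP => u; rewrite mem_gs_supp inE mon_coef; case: (u == _).
rewrite big_seq_fset1 !mon_coef eqxx subr_eq.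
by rewrite [X in _ = if m == X then _ else _]addrC; case: eqP.
Qed.

Lemma laurent_addff f : f + f = f.
Proof.
apply: gs_ext => m; rewrite -[LHS]/(gs_coef (gs_add _ _) m) gs_addE.
by case: (gs_coef f m) => // a; rewrite /GRing.add /= maxxx.
Qed.

Lemma laurent_eval0 p : laurent_eval (0 : laurent R n) p = None.
Proof. by apply: big1 => m _; rewrite /gs_coef fsfun0E. Qed.

Lemma mon_eval g p : laurent_eval (mon g) p = Some (term_eval g p).
Proof.
rewrite /laurent_eval (@gs_sum_supp _ _ _ [fset g.2]%fset); last first.
  by apply/fsubsetP => u; rewrite mem_gs_supp inE mon_coef; case: (u == _).
by rewrite big_seq_fset1 mon_coef eqxx.
Qed.

Definition terms f : seq term :=
  [seq (odflt 0 (gs_coef f m), m) | m <- gs_supp f].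

Lemma terms_sum f : f = \sum_(g <- terms f) mon g.
Proof.
apply: gs_ext => m.
have coefD (s : seq 'rV[int]_n) (F : 'rV[int]_n -> laurent R n) :
    gs_coef (\sum_(k <- s) F k) m = \sum_(k <- s) gs_coef (F k) m.
  elim: s => [|k s IH]; first by rewrite !big_nil /gs_coef fsfun0E.
  by rewrite !big_cons -[LHS]/(gs_coef (gs_add _ _) m) gs_addE IH.
rewrite /terms big_map coefD.
rewrite gs_coef_sum_delta big_seq [RHS]big_seq; apply: eq_bigr => k.
rewrite mem_gs_supp (mon_coef _ m) /= (eq_sym m).
by case: (gs_coef f k) => [a|] //= _; case: eqP.
Qed.

Lemma terms_eq0 f : terms f = [::] -> f = 0.
Proof. by move=> f0; rewrite (terms_sum f) f0 big_nil. Qed.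

Lemma sum_mon_eval (s : seq term) p :
  laurent_eval (\sum_(g <- s) mon g) p = \sum_(g <- s) (Some (term_eval g p) : trop R).
Proof.
elim: s => [|g s IH]; first by rewrite !big_nil laurent_eval0.
by rewrite !big_cons laurent_evalD mon_eval IH.
Qed.

Lemma sum_mon_eval_ge (s : seq term) g p : g \in s ->
  exists2 b, laurent_eval (\sum_(h <- s) mon h) p = Some b & term_eval g p <= b.
Proof.
rewrite sum_mon_eval; elim: s => // h s IH; rewrite big_cons inE => /orP[/eqP<-|/IH[b -> gb]].
  case: (\sum_(_ <- _) _) => [b|]; last by exists (term_eval g p).
  by exists (Num.max (term_eval g p) b) => //; rewrite le_max lexx.
by exists (Num.max (term_eval h p) b) => //; rewrite le_max gb orbT.
Qed.

Lemma sum_mon_eval_lt (s : seq term) c p : s != [::] ->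
    (forall g, g \in s -> term_eval g p < c) ->
  exists2 b, laurent_eval (\sum_(h <- s) mon h) p = Some b & b < c.
Proof.
rewrite sum_mon_eval; elim: s => // h s IH _ sc; rewrite big_cons.
have hc := sc h (mem_head _ _).
have [->|s0] := eqVneq s [::]; first by rewrite big_nil; exists (term_eval h p).
have [|b -> bc] := IH s0; first by move=> g gs; apply: sc; rewrite inE gs orbT.
by exists (Num.max (term_eval h p) b) => //; rewrite gt_max hc.
Qed.

Lemma term_evalN g p : term_eval (- g) p = - term_eval g p.
Proof.
rewrite /term_eval /dot_exp opprD; congr (_ + _).
by rewrite -sumrN; apply: eq_bigr => i _; rewrite mxE rmorphN mulNr.
Qed.

Lemma term_evalD g h p : term_eval (g + h) p = term_eval g p + term_eval h p.
Proof. by rewrite /term_eval dot_expD addrACA. Qed.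

Lemma term_eval_row g p : term_eval g p = (row_mx 1%:M p *m term_col g) 0 0.
Proof.
rewrite /term_col /exponent_col mul_row_col mul1mx !mxE eqxx mulr1n; congr (_ + _).
by apply: eq_bigr => i _; rewrite !mxE mulrC.
Qed.

Section LeadingTerm.
Variable C : set (laurent R n * laurent R n).
Hypothesis C_cong : congruence C.
Variable N : set term.
Hypothesis Ntotal : forall g, N g \/ N (- g).
Hypothesis ND : forall g h, N g -> N h -> N (g + h).
Hypothesis NC : forall g h, N (g - h) -> C (mon g + mon h, mon g).

(** Adding to a monomial a smaller one does not change its class, so a sum of
    monomials is congruent to the largest of them. *)
Lemma leading_term (s : seq term) : s != [::] ->
  exists g, [/\ g \in s, (forall h, h \in s -> N (g - h)) &
    C (\sum_(h <- s) mon h, mon g)].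
Proof.
have [Crefl _ Ctrans CD _] := C_cong.
have N0 : N 0 by have [] := Ntotal 0; rewrite ?oppr0.
elim: s => // h s IH _.
have [->|s0] := eqVneq s [::].
  exists h; split; rewrite ?mem_head//; last by rewrite big_seq1.
  by move=> g; rewrite inE => /eqP->; rewrite subrr.
have [g [gs gmax Cg]] := IH s0.
have [Nhg|] := Ntotal (h - g).
  exists h; split; rewrite ?mem_head//.
    move=> k; rewrite inE => /orP[/eqP->|ks]; first by rewrite subrr.
    by rewrite -(subrKA g); apply: ND => //; exact: gmax.
  rewrite big_cons; apply: (Ctrans) (NC Nhg).
  by apply: CD => //; exact: Crefl.
rewrite opprB => Ngh.
exists g; split; first by rewrite inE gs orbT.
  by move=> k; rewrite inE => /orP[/eqP->//|]; exact: gmax.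
rewrite big_cons; apply: (Ctrans) (NC Ngh).
by rewrite [mon g + _]addrC; apply: CD => //; exact: Crefl.
Qed.

End LeadingTerm.

Section PrimeOrder.
Variable C : set (laurent R n * laurent R n).
Hypothesis C_prime : prime_congruence C.

Definition prime_nonneg : set term := [set g | C (mon g + 1, mon g)].

Lemma prime_nonnegB g h : prime_nonneg (g - h) -> C (mon g + mon h, mon g).
Proof.
have [[Crefl _ _ _ CM] _ _] := C_prime.
move=> /CM /(_ (Crefl (mon h))); rewrite /= mulrDl mul1r monM.
by rewrite subrK.
Qed.

(** With [s = f1 + f2], idempotency makes [s * s + f1 * f2] and
    [s * f2 + f1 * s] equal, and primality applies to the pairs [(s, f1)] and
    [(s, f2)]. *)
Lemma prime_nonneg_or (f1 f2 : laurent R n) : C (f1 + f2, f1) \/ C (f1 + f2, f2).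
Proof.
have [[Crefl _ _ _ _] _ Cp] := C_prime.
apply: Cp.
have -> : (f1 + f2) * (f1 + f2) + f1 * f2 =
    f1 * f1 + (f1 * f2 + f1 * f2) + f1 * f2 + f2 * f2 by ring.
have -> : (f1 + f2) * f2 + f1 * (f1 + f2) =
    f1 * f1 + (f1 * f2 + f1 * f2) + f2 * f2 by ring.
by rewrite laurent_addff -(addrA (f1 * f1)) laurent_addff; exact: Crefl.
Qed.

Lemma prime_nonneg_total g : prime_nonneg g \/ prime_nonneg (- g).
Proof.
have [[Crefl _ _ _ CM] _ _] := C_prime.
have [|/CM /(_ (Crefl (mon (- g))))] := prime_nonneg_or (mon g) 1; first by left.
by rewrite /= mulrDl monM subrr mon0 !mul1r addrC; right.
Qed.

Lemma prime_nonnegD g h : prime_nonneg g -> prime_nonneg h -> prime_nonneg (g + h).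
Proof.
have [[Crefl Csym Ctrans CD CM] _ _] := C_prime.
rewrite /prime_nonneg /= => Cg Ch; have := CM _ _ _ _ Cg Ch; rewrite monM => Cgh.
apply: (Ctrans) (CD _ _ _ _ (Csym _ _ Cgh) (Crefl 1)) _.
have -> : (mon g + 1) * (mon h + 1) + 1 = (mon g + 1) * (mon h + 1).
  have -> : (mon g + 1) * (mon h + 1) = mon g * mon h + mon g + mon h + 1 by ring.
  by rewrite -addrA laurent_addff.
exact: Cgh.
Qed.

Lemma prime_monomial_neq0 g : ~ C (0, mon g).
Proof.
have [[Crefl Csym Ctrans CD CM] CT _] := C_prime => C0g; apply: CT.
have C01 : C (0, 1).
  have := CM _ _ _ _ C0g (Crefl (mon (- g))).
  by rewrite mul0r monM subrr.
have C0f f : C (0, f) by have := CM _ _ _ _ (Crefl f) C01; rewrite mulr0 mulr1.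
by apply/seteqP; split=> // -[f f'] _; apply: (Ctrans) (C0f f'); exact: Csym.
Qed.

Lemma prime_sum_one (s : seq term) : s != [::] ->
  C (\sum_(g <- s) mon g + 1, \sum_(g <- s) mon g) ->
  exists2 g, g \in s & prime_nonneg g.
Proof.
have [Ccong _ _] := C_prime; have [Crefl Csym Ctrans CD CM] := Ccong => s0 Cs.
have [g [gs _ Cg]] :=
  leading_term Ccong prime_nonneg_total prime_nonnegD prime_nonnegB s0.
exists g => //; apply: (Ctrans) (Cg); apply: (Ctrans) Cs.
by apply: CD; [exact: Csym | exact: Crefl].
Qed.

End PrimeOrder.

Definition positives_realised (V : set 'rV[R]_n) (N : set term) : Prop :=
  forall s : seq term, s != [::] -> (forall g, g \in s -> ~ N (- g)) ->
  exists2 p, V p & forall g, g \in s -> 0 < term_eval g p.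

(** Without a common point of positivity, adding [1] to the sum of the opposite
    terms does not change it on [V]; the congruence would then make one of the
    opposite terms nonnegative. *)
Lemma agreement_realised V (C : set (laurent R n * laurent R n)) :
  prime_congruence C -> agreement (@laurent_eval R n) V `<=` C ->
  positives_realised V (prime_nonneg C).
Proof.
move=> Cprime VC s s0 spos; apply: contrapT => Vs.
have s0' : [seq - g | g <- s] != [::] by case: (s) s0.
have [|_ /mapP[g gs ->] Ng] := prime_sum_one Cprime s0'; last exact: spos Ng.
apply: VC => p Vp /=.
have [g gs gp] : exists2 g, g \in s & term_eval g p <= 0.
  apply: contrapT => sp; apply: Vs; exists p => // g gs.
  by rewrite ltNge; apply/negP => gp; apply: sp; exists g.
have [b Eb gb] := @sum_mon_eval_ge [seq - g | g <- s] (- g) p (map_f _ gs).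
rewrite laurent_evalD Eb -mon0 mon_eval /GRing.add /=; congr Some; apply/max_idPl.
rewrite term_evalN in gb; apply: le_trans gb.
by rewrite /term_eval /dot_exp big1 ?addr0 ?oppr_ge0// => i _; rewrite mxE mul0r.
Qed.

Section GeneratedByMatrix.
Variables (l : nat) (U : 'M[R]_(l, 1 + n)).

Definition matrix_nonneg : set term := [set g | zero_or_first_pos (U *m term_col g)].

Lemma matrix_nonneg_total g : matrix_nonneg g \/ matrix_nonneg (- g).
Proof. by rewrite /matrix_nonneg /= raddfN mulmxN; exact: zero_or_first_pos_total. Qed.

Lemma matrix_nonnegD g h : matrix_nonneg g -> matrix_nonneg h -> matrix_nonneg (g + h).
Proof. by rewrite /matrix_nonneg /= raddfD mulmxDr; exact: zero_or_first_posD. Qed.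

Lemma congruence_P_congruence : congruence (congruence_P U).
Proof.
split.
- by move=> f A [[]].
- by move=> f g fg A AP; have [[_ + _ _ _] _] := AP; apply; exact: fg.
- by move=> f g h fg gh A AP; have [[_ _ + _ _] _] := AP; apply; [exact: fg | exact: gh].
- by move=> f g f' g' fg fg' A AP; have [[_ _ _ + _] _] := AP; apply; [exact: fg | exact: fg'].
- by move=> f g f' g' fg fg' A AP; have [[_ _ _ _ +] _] := AP; apply; [exact: fg | exact: fg'].
Qed.

Lemma matrix_nonnegB g h : matrix_nonneg (g - h) -> congruence_P U (mon g + mon h, mon g).
Proof.
move=> gh A [_]; apply; exists g.1, h.1, g.2, h.2; split=> //.
Qed.

Lemma congruence_P_leading f : f != 0 ->
  exists g, [/\ g \in terms f, (forall h, h \in terms f -> matrix_nonneg (g - h)) &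
    congruence_P U (f, mon g)].
Proof.
move=> f0; have tf0 : terms f != [::] by apply: contraNneq f0 => /terms_eq0->.
have := leading_term congruence_P_congruence matrix_nonneg_total matrix_nonnegD
  matrix_nonnegB tf0.
by rewrite -terms_sum.
Qed.

Lemma congruence_P_equivalent g h :
  matrix_nonneg (g - h) -> matrix_nonneg (h - g) -> congruence_P U (mon g, mon h).
Proof.
have [_ Csym Ctrans _ _] := congruence_P_congruence.
move=> /matrix_nonnegB gh /matrix_nonnegB; rewrite addrC => hg.
exact: Ctrans (Csym _ _ gh) hg.
Qed.

(** Both congruences identify a polynomial with its leading term and compare
    terms in the same way. *)
Lemma prime_congruence_PE (C : set (laurent R n * laurent R n)) :
  prime_congruence C -> (forall g, prime_nonneg C g <-> matrix_nonneg g) ->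
  C = congruence_P U.
Proof.
move=> Cprime CU; have [Ccong _ _] := Cprime.
have [Crefl Csym Ctrans _ _] := Ccong.
have PC : congruence_P U `<=` C.
  move=> fg; apply; split=> // _ [a1 [a2 [m1 [m2 [pos ->]]]]].
  by apply: (@prime_nonnegB _ Cprime (a1, m1) (a2, m2)); apply/CU.
apply/seteqP; split=> // -[f g] Cfg.
have [Prefl Psym Ptrans _ _] := congruence_P_congruence.
have [f0|f0] := eqVneq f 0; have [g0|g0] := eqVneq g 0.
- by rewrite f0 g0; exact: Prefl.
- have [x [_ _ /PC Cgx]] := congruence_P_leading g0.
  by case: (@prime_monomial_neq0 _ Cprime x); rewrite -f0; exact: Ctrans Cgx.
- have [x [_ _ /PC Cfx]] := congruence_P_leading f0.
  case: (@prime_monomial_neq0 _ Cprime x); rewrite -g0.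
  by apply: (Ctrans) Cfx; exact: Csym.
have [x [_ _ Pfx]] := congruence_P_leading f0.
have [y [_ _ Pgy]] := congruence_P_leading g0.
apply: (Ptrans) (Pfx) _; apply: (Ptrans _ (mon y)); last exact: Psym.
have Cxy : C (mon x, mon y).
  apply: (Ctrans) (PC _ Pgy); apply: (Ctrans) Cfg.
  by apply: Csym; exact: PC.
have Cnonneg g' h : C (mon g', mon h) -> matrix_nonneg (g' - h).
  move=> Cgh; apply/CU; rewrite /prime_nonneg /=.
  have [_ _ _ CD CM] := Ccong.
  have := CM _ _ _ _ Cgh (Crefl (mon (- h))); rewrite !monM subrr mon0 => Cgh1.
  apply: (Ctrans) (CD _ _ _ _ (Crefl _) (Csym _ _ Cgh1)) _.
  by rewrite laurent_addff.
by apply: congruence_P_equivalent; apply: Cnonneg => //; exact: Csym.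
Qed.

(** If the leading term of [f1] were strictly above that of [f2], it would
    exceed all terms of [f2] at some point of [V], where [f1] and [f2] take
    equal values. *)
Lemma realised_agreement V : V !=set0 -> positives_realised V matrix_nonneg ->
  agreement (@laurent_eval R n) V `<=` congruence_P U.
Proof.
move=> [p0 Vp0] real [f g] fg.
have [Prefl Psym Ptrans _ _] := congruence_P_congruence.
have eval_neq0 (f1 f2 : laurent R n) : (forall p, V p -> laurent_eval f1 p = laurent_eval f2 p) ->
    f1 = 0 -> f2 = 0.
  move=> f12 f10; apply: terms_eq0; apply/eqP/negPn/negP => t0.
  have := f12 p0 Vp0; rewrite f10 laurent_eval0 (terms_sum f2).
  case: (terms f2) t0 => // h s _.
  by have [b ->] := @sum_mon_eval_ge (h :: s) h p0 (mem_head _ _).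
have [f0|f0] := eqVneq f 0.
  by rewrite f0 (eval_neq0 f g fg f0); exact: Prefl.
have [g0|g0] := eqVneq g 0.
  by rewrite g0 (eval_neq0 g f (fun p Vp => esym (fg p Vp)) g0); exact: Prefl.
have leading_le (f1 f2 : laurent R n) x y :
    (forall p, V p -> laurent_eval f1 p = laurent_eval f2 p) ->
    x \in terms f1 -> y \in terms f2 ->
    (forall z, z \in terms f2 -> matrix_nonneg (y - z)) -> matrix_nonneg (y - x).
  move=> f12 xf yf ymax; apply: contrapT => yx.
  have [|z /mapP[t tf2 ->]|p Vp pos] := real [seq x - z | z <- terms f2].
  - by case: (terms f2) yf.
  - move=> Nzx; apply: yx; rewrite -(subrKA t); apply: matrix_nonnegD; first exact: ymax.
    by rewrite -opprB.
  have := f12 p Vp; rewrite (terms_sum f1) (terms_sum f2).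
  have [b -> xb] := sum_mon_eval_ge p xf.
  have [|z zf2|b' -> bx] := @sum_mon_eval_lt (terms f2) (term_eval x p) p.
  - by case: (terms f2) yf.
  - have := pos (x - z) (map_f _ zf2).
    by rewrite term_evalD term_evalN subr_gt0.
  by case=> bb'; have := lt_le_trans bx xb; rewrite bb' ltxx.
have [x [xf xmax Pfx]] := congruence_P_leading f0.
have [y [yg ymax Pgy]] := congruence_P_leading g0.
apply: (Ptrans) (Pfx) _; apply: (Ptrans _ (mon y)); last exact: Psym.
apply: congruence_P_equivalent.
  by apply: (leading_le g f) => // p /fg.
exact: (leading_le f g).
Qed.

End GeneratedByMatrix.

End LaurentTerms.

(** * Reduction of the three semirings to Laurent polynomials *)

Section FunctionSemirings.

Lemma pullback_prime (S S' : comPzSemiRingType) (phi : S -> S')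
    (P : set (S' * S')) :
  {morph phi : a b / a + b} -> {morph phi : a b / a * b} ->
  phi 0 = 0 -> phi 1 = 1 ->
  prime_congruence P -> prime_congruence (pullback_congruence phi P).
Proof.
move=> phiD phiM phi0 phi1 [[Prefl Psym Ptrans PD PM] PT Pprime].
split; rewrite /pullback_congruence /=.
- split=> /=.
  + by move=> a; exact: Prefl.
  + by move=> a b; exact: Psym.
  + by move=> a b c; exact: Ptrans.
  + by move=> a b c d ab cd; rewrite !phiD; exact: PD.
  + by move=> a b c d ab cd; rewrite !phiM; exact: PM.
- move=> PT'; apply: PT; apply/seteqP; split=> // -[a b] _.
  have P01 : P (0, 1).
    by have : [set: S * S] (0, 1) by []; rewrite -PT' /= phi0 phi1.
  have P0 c : P (0, c) by have := PM _ _ _ _ (Prefl c) P01; rewrite mulr0 mulr1.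
  by apply: (Ptrans) (P0 b); exact: Psym.
- by move=> a b c d; rewrite !phiD !phiM; exact: Pprime.
Qed.

Variables (R : realType) (n : nat).

Lemma laurent_fun_projD : {morph @laurent_fun_proj R n : f g / f + g}.
Proof.
by move=> f g; symmetry; exact: (quot_addE (laurent_agreement_congruence setT)).
Qed.

Lemma laurent_fun_projM : {morph @laurent_fun_proj R n : f g / f * g}.
Proof.
by move=> f g; symmetry; exact: (quot_mulE (laurent_agreement_congruence setT)).
Qed.

Local Notation cancel := (@laurent_fun_cancellative R n).

Lemma rational_fun_injD : {morph @rational_fun_inj R n : a b / a + b}.
Proof.
move=> a b; apply: etrans (esym (frac_addE cancel _ _)).
by apply/frac_projP; rewrite !(fracE cancel); ring.
Qed.

Lemma rational_fun_injM : {morph @rational_fun_inj R n : a b / a * b}.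
Proof.
move=> a b; apply: etrans (esym (frac_mulE cancel _ _)).
by apply/frac_projP; rewrite !(fracE cancel); ring.
Qed.

Lemma fs_map_prime k (P : set (fs_semiring R n k * fs_semiring R n k)) :
  prime_congruence P -> prime_congruence (pullback_congruence (@fs_map R n k) P).
Proof.
case: k P => P /=.
- by apply: pullback_prime.
- by apply: pullback_prime => //; [exact: laurent_fun_projD | exact: laurent_fun_projM].
- apply: pullback_prime => //.
  + by move=> f g /=; rewrite laurent_fun_projD rational_fun_injD.
  + by move=> f g /=; rewrite laurent_fun_projM rational_fun_injM.
Qed.

Lemma fs_eval_map k (f : laurent R n) p :
  fs_eval (@fs_map R n k f) p = laurent_eval f p.
Proof.
case: k => //=; first exact: laurent_fun_eval_proj.
by rewrite rational_fun_eval_inj laurent_fun_eval_proj.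
Qed.

Definition rational_fun_inv (b : laurent_fun R n) (hb : b != 0) : rational_fun R n :=
  frac_proj cancel (mk_fraction 1 hb).

(** Multiplying by [c / c] brings two fractions to a common denominator, so that
    congruence of fractions reduces to congruence of numerators. *)
Lemma rational_fun_split (r : fraction (laurent_fun R n)) (c : laurent_fun R n) (hc : c != 0) :
  frac_proj cancel r = rational_fun_inj (numer r * c) *
      (rational_fun_inv hc * rational_fun_inv (denom_neq0 r)).
Proof.
have -> : rational_fun_inv hc * rational_fun_inv (denom_neq0 r) =
    frac_proj cancel (fraction_mul cancel (mk_fraction 1 hc) (mk_fraction 1 (denom_neq0 r))).
  exact: frac_mulE.
apply: etrans (esym (frac_mulE cancel _ _)).
by apply/frac_projP; rewrite !(fracE cancel); ring.
Qed.

Lemma congruence_E_sub k (V : set 'rV[R]_n)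
    (P : set (fs_semiring R n k * fs_semiring R n k)) :
  congruence P ->
  (@congruence_E R n k V `<=` P <->
   agreement (@laurent_eval R n) V `<=` pullback_congruence (@fs_map R n k) P).
Proof.
move=> Pcong; split=> [VP [f g] fg|VP].
  by apply: VP => p Vp; rewrite /= !fs_eval_map; exact: fg.
case: k P Pcong VP => P Pcong VP; first by move=> [a b] /VP.
  move=> [a b] ab; rewrite -(quot_reprK a) -(quot_reprK b).
  by apply: (VP (quot_repr a, quot_repr b)) => p Vp /=; exact: (ab p Vp).
have VP' (a b : laurent_fun R n) :
    (forall p, V p -> laurent_fun_eval a p = laurent_fun_eval b p) ->
    P (rational_fun_inj a, rational_fun_inj b).
  move=> ab; rewrite -(quot_reprK a) -(quot_reprK b).
  by apply: (VP (quot_repr a, quot_repr b)) => p Vp /=; exact: ab.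
have [Prefl _ _ _ PM] := Pcong.
move=> [q1 q2]; rewrite -(frac_reprK q1) -(frac_reprK q2).
move: (frac_repr q1) (frac_repr q2) => r1 r2 r12.
rewrite (rational_fun_split r1 (denom_neq0 r2)) (rational_fun_split r2 (denom_neq0 r1)).
rewrite [X in rational_fun_inj (numer r2 * denom r1) * X]mulrC.
apply: PM (Prefl _); apply: VP' => p Vp; rewrite !laurent_fun_evalM.
have := r12 p Vp; rewrite /= !rational_fun_eval_proj.
have := laurent_fun_eval_neq0 p (denom_neq0 r1).
have := laurent_fun_eval_neq0 p (denom_neq0 r2).
case: (laurent_fun_eval (denom r1) p) => // d1; case: (laurent_fun_eval (denom r2) p) => // d2.
case: (laurent_fun_eval (numer r1) p) => [a1|]; case: (laurent_fun_eval (numer r2) p) => [a2|] //= _ _.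
by case=> a12; rewrite /GRing.mul /=; congr Some; lra.
Qed.

End FunctionSemirings.

(** * Points of V at which positive terms take positive values *)

Section CasesRealised.
Variables (R : realType) (n : nat).
Implicit Types (m : 'rV[int]_n) (p q : 'rV[R]_n) (g : term R n).

Definition exp_col m : 'cV[R]_n := (map_mx intr m)^T.

Lemma dot_expE m p : dot_exp m p = (p *m exp_col m) 0 0.
Proof. by rewrite mxE; apply: eq_bigr => i _; rewrite !mxE mulrC. Qed.

Lemma dot_exp_addr m p q : dot_exp m (p + q) = dot_exp m p + dot_exp m q.
Proof. by rewrite !dot_expE mulmxDl mxE. Qed.

Lemma dot_exp_scaler m c p : dot_exp m (c *: p) = c * dot_exp m p.
Proof. by rewrite !dot_expE -scalemxAl mxE. Qed.

Lemma dot_exp_sumr m (I : Type) (r : seq I) (P : pred I) (F : I -> 'rV[R]_n) :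
  dot_exp m (\sum_(i <- r | P i) F i) = \sum_(i <- r | P i) dot_exp m (F i).
Proof. by rewrite dot_expE mulmx_suml summxE; apply: eq_bigr => i _; rewrite dot_expE. Qed.

Lemma matrix_Z_term l (y : 'M[R]_(l, n)) g j :
  (matrix_Z y *m term_col g) j 0 = dot_exp g.2 (row j y).
Proof. by rewrite /term_col mul_row_col mul0mx add0r dot_expE -row_mul [RHS]mxE. Qed.

Lemma matrix_U_term l (x : 'M[R]_(l, n)) k g j :
  (matrix_U x k *m term_col g) j 0 = (j == k)%:R * g.1 + dot_exp g.2 (row j x).
Proof.
rewrite /term_col mul_row_col mxE dot_expE -row_mul [in RHS]mxE; congr (_ + _).
by rewrite mul_mx_scalar !mxE andbT mulrC.
Qed.

Lemma recession_translate (Q : rational_polyhedron R n) z q c :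
  polyhedral_set Q z -> recession_cone Q q -> 0 <= c -> polyhedral_set Q (z + c *: q).
Proof.
move=> Qz Qq c0 i; have -> : (z + c *: q)^T = z^T + c *: q^T by apply/colP => h; rewrite !mxE.
rewrite mulmxDr -scalemxAr mxE [X in _ + X]mxE -[leLHS]addr0; apply: lerD; first exact: Qz.
by apply: mulr_ge0 => //; have := Qq i; rewrite mxE.
Qed.

Definition flag_coef l (eps : 'I_l -> R) (i : 'I_l) : R := if i == 0 :> nat then 1 else eps i.

Lemma flag_vectorE l (x : 'M[R]_(l, n)) eps j :
  flag_vector x eps j = \sum_(i < l | (i <= j)%N) flag_coef eps i *: row i x.
Proof.
apply: eq_bigr => i _; rewrite /flag_coef; case: ifP => // _.
by rewrite scale1r.
Qed.

Lemma flag_dot l (x : 'M[R]_(l, n)) eps m (j : 'I_l) :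
  (forall i : 'I_l, (i < j)%N -> dot_exp m (row i x) = 0) ->
  dot_exp m (flag_vector x eps j) = flag_coef eps j * dot_exp m (row j x).
Proof.
move=> m0; rewrite flag_vectorE dot_exp_sumr (bigD1 j)//= dot_exp_scaler big1 ?addr0// => i.
move=> /andP[ij i_neq]; have ij' : (i < j)%N by rewrite ltn_neqAle ij andbT.
by rewrite dot_exp_scaler m0// mulr0.
Qed.

Lemma eventually_small_affine (a b : R) : 0 < b -> eventually_small (fun t => 0 < t * a + b).
Proof.
move=> b0; have d0 : 0 < 1 + `|a| by rewrite ltr_pwDl.
exists (b / (1 + `|a|)) => [|t t0]; first exact: divr_gt0.
by rewrite ler_pdivlMr// => tab; have := ler_norm (- a); rewrite normrN; nra.
Qed.

(** The curve of the sums [t^j F_j] of flag vectors runs inside the recession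
    cones.  Replacing the rows [y_j] by [F_j] is a triangular change, so for
    small [t] the direction has positive product with all exponents; a far point
    in that direction then makes the whole terms positive. *)
Lemma case1_realised N (Q : 'I_N -> rational_polyhedron R n) d l (U : 'M[R]_(l, 1 + n)) :
  (forall i, polyhedral_set (Q i) !=set0) ->
  case1 (\bigcup_i recession_cone (Q i)) d U ->
  positives_realised (\bigcup_i polyhedral_set (Q i)) (matrix_nonneg U).
Proof.
move=> Q0 [y [-> _ _ [eps [eps0 cone_rec]]]] s _ spos.
pose v' g : 'cV[R]_l := \col_j dot_exp g.2 (flag_vector y eps j).
have v'pos g : g \in s -> first_pos (v' g).
  move=> gs; have : first_pos (matrix_Z y *m term_col g).
    by apply/zero_or_first_posNP; have := spos g gs; rewrite /matrix_nonneg /= raddfN mulmxN.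
  apply: triangular_first_pos => j m0; exists (flag_coef eps j).
    by rewrite /flag_coef; case: eqP => // /eqP; rewrite -lt0n; exact: eps0.
  rewrite mxE matrix_Z_term; apply: flag_dot => i ij.
  by have := m0 i ij; rewrite matrix_Z_term.
have [t t0 tpos] := eventually_small_ex
  (eventually_small_all (fun g gs => first_pos_eventually (v'pos g gs))).
pose q := \sum_(j < l) t ^+ j *: flag_vector y eps j.
have [|i _ recq] := cone_rec q.
  by exists (fun j : 'I_l => t ^+ j); split=> // j; rewrite exprn_ge0// ltW.
have qpos g : g \in s -> 0 < dot_exp g.2 q.
  move=> /tpos; rewrite dot_exp_sumr; congr (0 < _); apply: eq_bigr => j _.
  by rewrite dot_exp_scaler mxE.
have [z0 Qz0] := Q0 i.
have [c c0 cpos] := eventually_small_ex (eventually_small_all (fun g gs =>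
  eventually_small_affine (term_eval g z0) (qpos g gs))).
exists (z0 + c^-1 *: q).
  by exists i => //; apply: recession_translate => //; rewrite invr_ge0 ltW.
move=> g gs; rewrite /term_eval dot_exp_addr addrA -/(term_eval g z0) dot_exp_scaler.
by have := cpos g gs; rewrite -(pmulr_rgt0 _ (_ : 0 < c^-1)) ?invr_gt0// mulrDr mulKf ?gt_eqF.
Qed.

(** The matrix with rows [(0, F_j)] before [k], [(1, z)] at [k] and [(0, x_j)]
    after [k] is a triangular change of [U].  Combining its rows with weights
    [t^(j - k)] gives a point of the box plus cone as soon as [t] is small. *)
Lemma case2_realised (V : set 'rV[R]_n) d l (U : 'M[R]_(l, 1 + n)) :
  case2 V d U -> positives_realised V (matrix_nonneg U).
Proof.
move=> [x [k [-> _ _ [eps [z [eps0 zcone Vz]]]]]] s _ spos.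
have kl : (k <= l)%N by exact: ltnW.
pose v' g : 'cV[R]_l := \col_j
  if (j < k)%N then dot_exp g.2 (flag_vector x eps j)
  else if j == k then term_eval g z else dot_exp g.2 (row j x).
have v'pos g : g \in s -> first_pos (v' g).
  move=> gs; have : first_pos (matrix_U x k *m term_col g).
    by apply/zero_or_first_posNP; have := spos g gs; rewrite /matrix_nonneg /= raddfN mulmxN.
  apply: triangular_first_pos => j m0.
  have m0' (i : 'I_l) : (i < j)%N -> (i < k)%N -> dot_exp g.2 (row i x) = 0.
    move=> ij ik; have := m0 i ij.
    by rewrite matrix_U_term -val_eqE /= (ltn_eqF ik) mul0r add0r.
  rewrite mxE matrix_U_term; case: ltngtP => [jk|kj|/val_inj jk].
  - rewrite -val_eqE (ltn_eqF jk) mul0r add0r.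
    exists (flag_coef eps j); last by apply: flag_dot => i ij; apply: m0' => //; exact: ltn_trans jk.
    rewrite /flag_coef; case: eqP => // /eqP j0; apply: eps0; first by rewrite lt0n.
    by rewrite -val_eqE (ltn_eqF jk).
  - exists 1; rewrite // -val_eqE (gtn_eqF kj) mul0r add0r mul1r.
    by [].
  - move: m0'; rewrite jk => m0'; exists 1; rewrite // eqxx !mul1r.
    have [_ -> [_ [c [_ ->]] <-]] := zcone.
    rewrite /term_eval dot_exp_addr dot_exp_sumr big1 ?addr0// => i _.
    have i_lt : (i < k)%N by case: (i).
    have ik : (i < l)%N by exact: leq_trans kl.
    rewrite dot_exp_scaler (@flag_dot _ x eps g.2 (Ordinal ik)).
      by rewrite m0' ?mulr0.
    by move=> i' i'i; apply: m0'; exact: ltn_trans i'i _.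
pose small t := forall j : 'I_l, (k < j)%N -> t <= eps j.
have ev_small : eventually_small (fun t => t <= 1 /\ small t).
  apply: eventually_small_and; first exact: eventually_small_le.
  apply: eventually_small_forall => j; have [kj|_] := ltnP k j; last by exists 1.
  suff: eventually_small (fun t => t <= eps j) by apply: eventually_smallW.
  apply: eventually_small_le; apply: eps0; first exact: leq_ltn_trans kj.
  by rewrite -val_eqE gtn_eqF.
have [t t0 [tpos [t1 tsmall]]] := eventually_small_ex (eventually_small_and
  (eventually_small_all (fun g gs => first_pos_eventually (v'pos g gs))) ev_small).
pose q1 := \sum_(i < l | (k < i)%N) t ^+ (i - k) *: row i x.
pose q2 := \sum_(j < k) (t ^+ j / t ^+ k) *: flag_vector x eps j.
exists (z + q1 + q2).
  apply: Vz; exists (z + q1); last first.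
    exists q2 => //; exists (fun j : 'I_k => t ^+ j / t ^+ k); split=> // j.
    by rewrite divr_ge0 ?exprn_ge0// ltW.
  exists (fun i : 'I_l => t ^+ (i - k)) => // i ki.
  rewrite exprn_ge0 ?(ltW t0)//=; apply: le_trans (tsmall i ki).
  rewrite -[leRHS]expr1; apply: ler_wiXn2l; rewrite ?(ltW t0)//.
  by rewrite subn_gt0.
move=> g gs; suff -> : term_eval g (z + q1 + q2) = (\sum_(j < l) t ^+ j * v' g j 0) / t ^+ k.
  by rewrite divr_gt0 ?exprn_gt0//; exact: tpos.
rewrite mulr_suml (bigID (fun j : 'I_l => (j < k)%N)) /= addrC.
rewrite [X in _ = X + _](bigD1 k) ?ltnn//=.
rewrite mxE ltnn eqxx -mulrA mulrCA divff ?mulr1; last by rewrite expf_neq0 ?gt_eqF.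
rewrite /term_eval !dot_exp_addr 2!addrA; congr (_ + _ + _).
- rewrite dot_exp_sumr; apply: eq_big => j; first by rewrite -leqNgt ltn_neqAle eq_sym andbC.
  move=> kj; rewrite dot_exp_scaler mxE ltnNge (ltnW kj) /= -val_eqE (gtn_eqF kj).
  rewrite -[in RHS](subnK (ltnW kj)) exprD mulrAC mulfK//.
  by rewrite expf_neq0 ?gt_eqF.
- rewrite dot_exp_sumr (big_ord_narrow kl); apply: eq_bigr => j _.
  by rewrite dot_exp_scaler mxE /= ltn_ord mulrAC.
Qed.

End CasesRealised.

(** * Matrices nonnegative on the inequalities of a polyhedron *)

Section RealisedCases.
Variables (R : realType) (n : nat).
Implicit Types (m : 'rV[int]_n) (p q : 'rV[R]_n) (g : term R n).

Lemma integral_multiple (r : 'I_n -> rat) :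
  exists2 D : int, 0 < D & exists m, forall j, (m 0 j)%:~R = D%:~R * r j.
Proof.
exists (\prod_j denq (r j)); first by apply: prodr_gt0 => j _; exact: denq_gt0.
exists (\row_j (numq (r j) * \prod_(i | i != j) denq (r i))) => j.
rewrite mxE [in RHS](bigD1 j)//= !intrM -[X in _ = _ * X]divq_num_den.
have d0 : (denq (r j))%:~R != 0 :> rat by rewrite intr_eq0 denq_neq0.
by field.
Qed.

(** Clearing the denominators of a row of the rational matrix turns the
    inequality into the nonnegativity of a term. *)
Lemma polyhedron_terms (Q : rational_polyhedron R n) :
  exists ct : 'I_(ineq_number Q) -> term R n,
    (forall p, polyhedral_set Q p <-> forall c, 0 <= term_eval (ct c) p) /\
    (forall q, recession_cone Q q <-> forall c, 0 <= dot_exp (ct c).2 q).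
Proof.
pose A : 'M[R]_(ineq_number Q, n) := map_mx ratr (ineq_matrix Q).
have Drow c : exists Dm : R * 'rV[int]_n,
    0 < Dm.1 /\ forall q, dot_exp Dm.2 q = Dm.1 * (A *m q^T) c 0.
  have [D D0 [m mE]] := integral_multiple (fun j => ineq_matrix Q c j).
  exists (D%:~R, m); split=> [|q]; first by rewrite ltr0z.
  rewrite mxE mulr_sumr; apply: eq_bigr => j _; rewrite !mxE mulrA; congr (_ * _).
  by have := congr1 (@ratr R) (mE j); rewrite rmorphM /= !ratr_int.
have [f fP] := choice Drow.
exists (fun c => (- ((f c).1 * ineq_bound Q c 0), (f c).2)); split=> p.
  split=> Qp c.
    have [f0 fE] := fP c.
    by rewrite /term_eval /= fE addrC subr_ge0 ler_pM2l//; exact: Qp.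
  have [f0 fE] := fP c.
  by have := Qp c; rewrite /term_eval /= fE addrC subr_ge0 ler_pM2l.
split=> Qp c; have [f0 fE] := fP c.
  by rewrite /= fE pmulr_rge0//; have := Qp c; rewrite mxE.
by have := Qp c; rewrite /= fE pmulr_rge0// [X in _ -> X <= _]mxE.
Qed.

(** Otherwise every [Q i] has an inequality term whose opposite is strictly
    positive; a common point of positivity of these opposites lies in no
    [Q i]. *)
Lemma realised_polyhedron N (Q : 'I_N -> rational_polyhedron R n) (pos : set (term R n))
    (ct : forall i, 'I_(ineq_number (Q i)) -> term R n) :
  (0 < N)%N ->
  (forall i p, polyhedral_set (Q i) p -> forall c, 0 <= term_eval (ct i c) p) ->
  positives_realised (\bigcup_i polyhedral_set (Q i)) pos ->
  exists i, forall c, pos (ct i c).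
Proof.
move=> N0 ctQ real; apply: contrapT => noQ.
have bad i : exists g, ~ pos g /\ forall p, polyhedral_set (Q i) p -> 0 <= term_eval g p.
  apply: contrapT => nobad; apply: noQ; exists i => c; apply: contrapT => Nc.
  by apply: nobad; exists (ct i c); split=> // p /ctQ.
have [h hP] := choice bad.
have [||p [i _ Qp] pos_p] := real [seq - h i | i <- enum 'I_N].
- by rewrite -size_eq0 size_map size_enum_ord -lt0n.
- by move=> _ /mapP[i _ ->]; rewrite opprK; have [] := hP i.
have := pos_p _ (map_f (fun i => - h i) (mem_enum 'I_N i)).
by have [_ /(_ p Qp)] := hP i; rewrite term_evalN oppr_gt0 leNgt => /negPf->.
Qed.

Lemma affine_dim_ge (A : set 'rV[R]_n) z r (B : 'M[R]_(r, n)) :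
  A z -> row_free B -> (forall i, exists2 c, c != 0 & A (z + c *: row i B)) ->
  (r <= affine_dim A)%N.
Proof.
move=> Az Bfree AB.
have [x0 [W [AW <-]]] : is_affine_dim A (affine_dim A) by apply: affine_dimP; exists z.
have sub_span y : A y -> y - x0 \in W.
  move=> Ay; have : affine_span A y.
    exists [:: (1, y)]; split; rewrite ?big_seq1 ?scale1r//.
    by move=> q; rewrite inE => /eqP->.
  by rewrite AW => -[w wW <-]; rewrite addrC addKr.
have BW i : row i B \in W.
  have [c c0 Ac] := AB i.
  have : c *: row i B \in W.
    have -> : c *: row i B = (z + c *: row i B - x0) - (z - x0).
      by rewrite opprB addrA subrK addrC addKr.
    by apply: memvB; exact: sub_span.
  by move=> /(memvZ c^-1); rewrite scalerA mulVf// scale1r.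
pose X := [tuple row i B | i < r].
have Xfree : free X.
  apply/freeP => a aX.
  have aB : (\row_i a i) *m B = 0.
    rewrite mulmx_sum_row -[RHS]aX; apply: eq_bigr => i _.
    by rewrite mxE (nth_map i) ?size_enum_ord// nth_ord_enum.
  move=> i; have /rowP/(_ i) : \row_i a i = 0.
    by apply: (row_free_inj Bfree); rewrite aB mul0mx.
  by rewrite !mxE.
have -> : r = \dim <<X>> by move: Xfree; rewrite /free => /eqP ->; rewrite size_tuple.
by apply/dimvS/span_subvP => v /mapP[i _ ->].
Qed.

Lemma lower_triangular_change l (L : 'M[R]_l) (v : 'cV[R]_l) :
  (forall i j : 'I_l, (i < j)%N -> L i j = 0) -> (forall i, 0 < L i i) ->
  triangular_change v (L *m v).
Proof.
move=> Lupper Ldiag j v0; exists (L j j) => //.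
rewrite mxE (bigD1 j)//= big1 ?addr0// => i ij.
have [/v0->|ji|/val_inj/eqP] := ltngtP i j; first by rewrite mulr0.
  by rewrite Lupper// mul0r.
by rewrite (negPf ij).
Qed.

(** Gaussian elimination below the pivot [a k 0]. *)
Definition pivot_matrix l (a : 'cV[R]_l) (k : 'I_l) : 'M[R]_l :=
  \matrix_(i, j) if j == k then
    (if i == k then (a k 0)^-1 else if (k < i)%N then - (a i 0 / a k 0) else 0)
    else (i == j)%:R.

Lemma pivot_matrix_change l (a : 'cV[R]_l) k v :
  0 < a k 0 -> triangular_change v (pivot_matrix a k *m v).
Proof.
move=> ak; apply: lower_triangular_change => [i j ij|i]; rewrite mxE.
  have [jk|_] := eqVneq j k; last by rewrite -val_eqE (ltn_eqF ij).
  by rewrite -jk -val_eqE (ltn_eqF ij) ltnNge (ltnW ij).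
by rewrite eqxx; case: eqP => // _; rewrite ?invr_gt0 ?ltr01.
Qed.

Lemma pivot_matrixE l (a : 'cV[R]_l) k :
  first_nonzero_at a k -> pivot_matrix a k *m a = delta_mx k 0.
Proof.
move=> [ak a0]; apply/colP => i; rewrite [LHS]mxE (bigD1 k)//= !mxE eqxx andbT.
have [->|ik] := eqVneq i k.
  rewrite mulVf// big1 ?addr0// => j jk.
  by rewrite mxE (negPf jk) eq_sym (negPf jk) mul0r.
rewrite (bigD1 i)//= big1 ?addr0 => [|j /andP[jk ji]]; last first.
  by rewrite mxE (negPf jk) eq_sym (negPf ji) mul0r.
rewrite mxE (negPf ik) eqxx mul1r.
case: ltngtP => [ki|{}ik|/val_inj/esym/eqP]; last by rewrite (negPf ik).
  by rewrite mulNr divfK// addNr.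
by rewrite mul0r add0r a0.
Qed.

(** For small [t], adds to each row large multiples of the earlier rows
    satisfying [keep], the earlier the larger. *)
Definition spread_matrix l (keep : pred 'I_l) (t : R) : 'M[R]_l :=
  \matrix_(j, i) if i == j then 1 else if (i < j)%N && keep i then t ^+ i / t ^+ j else 0.

Lemma spread_matrix_change l (keep : pred 'I_l) t v :
  triangular_change v (spread_matrix keep t *m v).
Proof.
apply: lower_triangular_change => [i j ij|i]; rewrite mxE ?eqxx//.
by rewrite -val_eqE (gtn_eqF ij) ltnNge (ltnW ij).
Qed.

(** Row [j] of the product is, up to a positive factor, a sum with weights
    [t^i] over the kept entries up to [j]; it is dominated by the first nonzero
    entry of [v], unless that entry is one that is not kept. *)
Lemma spread_matrix_nonneg l (keep : pred 'I_l) (v : 'cV[R]_l) :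
  zero_or_first_pos v -> eventually_small (fun t =>
    (forall j, 0 <= (spread_matrix keep t *m v) j 0) \/
    exists2 i, ~~ keep i & (forall j : 'I_l, (j < i)%N -> (spread_matrix keep t *m v) j 0 = 0) /\
      0 < (spread_matrix keep t *m v) i 0).
Proof.
move=> [->|[i [vi vi0]]].
  by exists 1 => // t _ _; left => j; rewrite mulmx0 mxE.
have [ki|ki] := boolP (keep i); last first.
  exists 1 => // t _ _; right; exists i => //.
  have [[_ v0] pos] := triangular_first_nonzero (@spread_matrix_change _ keep t v) vi.
  by split; [exact: v0 | exact: pos].
pose w j : 'cV[R]_l := \col_h if h == j then v j 0 else
  if (h < j)%N && keep h then v h 0 else 0.
have wE j t : 0 < t -> (spread_matrix keep t *m v) j 0 = (\sum_(h < l) t ^+ h * w j h 0) / t ^+ j.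
  move=> t0; rewrite mxE mulr_suml; apply: eq_bigr => h _; rewrite !mxE.
  have tj : t ^+ j != 0 by rewrite expf_neq0 ?gt_eqF.
  have [->|_] := eqVneq h j; first by rewrite mul1r mulrAC divff// mul1r.
  by case: ifP => _; rewrite ?mulr0 ?mul0r// mulrAC.
suff: eventually_small (fun t => forall j, 0 <= (spread_matrix keep t *m v) j 0).
  by apply: eventually_smallW => t _ ?; left.
apply: eventually_small_forall => j; have [vi1 v0] := vi.
have [ji|ij] := ltnP j i.
  exists 1 => // t t0 _; rewrite wE// big1 ?mul0r// => h _; rewrite mxE.
  have [_|_] := eqVneq h j; first by rewrite v0 ?mulr0.
  by case: ifP => [/andP[hj _]|_]; rewrite ?mulr0// v0 ?mulr0//; exact: ltn_trans ji.
have wi (h : 'I_l) : (h <= i)%N -> w j h 0 = v h 0.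
  move=> hi; rewrite mxE; have [->//|hj] := eqVneq h j.
  have hj' : (h < j)%N by rewrite ltn_neqAle hj (leq_trans hi ij).
  rewrite hj' /=; case: ifP => // kh; rewrite v0// ltn_neqAle hi andbT.
  by apply: contraFN kh => /eqP/val_inj->.
have wpos : first_pos (w j).
  exists i; rewrite /first_nonzero_at wi//; split=> //; split=> // h hi.
  by rewrite wi ?v0// ltnW.
apply: eventually_smallW (first_pos_eventually wpos) => t t0 tpos.
by rewrite wE// ltW// divr_gt0// exprn_gt0.
Qed.

Section OrderCases.
Variables (N : nat) (Q : 'I_N -> rational_polyhedron R n).
Variables (ct : forall i, 'I_(ineq_number (Q i)) -> term R n) (i0 : 'I_N).
Arguments ct : clear implicits.
Hypothesis Q_neq0 : forall i, polyhedral_set (Q i) !=set0.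
Hypothesis ctQ : forall i p, polyhedral_set (Q i) p <-> forall c, 0 <= term_eval (ct i c) p.
Hypothesis ctrec : forall i q, recession_cone (Q i) q <-> forall c, 0 <= dot_exp (ct i c).2 q.

Local Notation V := (\bigcup_i polyhedral_set (Q i)).
Local Notation recV := (\bigcup_i recession_cone (Q i)).
Local Notation d := (\max_(i < N) affine_dim (polyhedral_set (Q i)))%N.

Lemma flag_dot_ge0 l (x : 'M[R]_(l, n)) eps m (j : nat) :
  (forall i : 'I_l, (i <= j)%N -> 0 <= eps i) ->
  (forall i : 'I_l, (i <= j)%N -> 0 <= dot_exp m (row i x)) ->
  0 <= dot_exp m (flag_vector x eps j).
Proof.
move=> eps0 x0; rewrite flag_vectorE dot_exp_sumr; apply: sumr_ge0 => i ij.
rewrite dot_exp_scaler mulr_ge0 ?x0// /flag_coef.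
by case: ifP => // _; exact: eps0.
Qed.

(** Each row of [y] is a recession direction of the polyhedron, so every
    nonnegative combination of flag vectors is one, with all [eps] equal to
    one. *)
Lemma nonneg_case1 l (y : 'M[R]_(l, n)) :
  (0 < l)%N ->
  (forall i, exists g, first_nonzero_at (matrix_Z y *m term_col g) i) ->
  (forall c j, 0 <= (matrix_Z y *m term_col (ct i0 c)) j 0) ->
  case1 recV d (matrix_Z y).
Proof.
move=> l0 yrows ypos.
have yfree : row_free y.
  apply: first_nonzero_row_free => i; have [g gi] := yrows i.
  exists (exp_col R g.2); suff -> : y *m exp_col R g.2 = matrix_Z y *m term_col g by [].
  by apply/colP => j; rewrite matrix_Z_term dot_expE -row_mul [RHS]mxE.
have ypos' c j : 0 <= dot_exp (ct i0 c).2 (row j y) by rewrite -matrix_Z_term.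
exists y; split=> //.
  rewrite l0 /=; apply: leq_trans (leq_bigmax i0).
  have [z Qz] := Q_neq0 i0; apply: (affine_dim_ge Qz yfree) => i.
  exists 1; rewrite ?oner_neq0//; apply: recession_translate => //.
  by apply/ctrec => c.
exists (fun=> 1); split=> // _ [c [c0 ->]]; exists i0 => //; apply/ctrec => a.
rewrite dot_exp_sumr; apply: sumr_ge0 => j _; rewrite dot_exp_scaler mulr_ge0//.
exact: flag_dot_ge0.
Qed.

(** The witnesses are [z = x_k], [eps = 1] before [k], and after [k] a common
    [eps] small against the positive entries [u k]: the terms with [u k] as
    first nonzero entry may be negative further on, all other inequality terms
    do not decrease in any direction used. *)
Lemma nonneg_case2 l (x : 'M[R]_(l, n)) (k : 'I_l) :
  (forall i, exists g, first_nonzero_at (matrix_U x k *m term_col g) i) ->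
  (forall c, let u := matrix_U x k *m term_col (ct i0 c) in
     (forall j, 0 <= u j 0) \/
     (forall j : 'I_l, (j < k)%N -> u j 0 = 0) /\ 0 < u k 0) ->
  case2 V d (matrix_U x k).
Proof.
move=> xrows xpos; pose u c := matrix_U x k *m term_col (ct i0 c).
have udot c j : j != k -> u c j 0 = dot_exp (ct i0 c).2 (row j x).
  by move=> jk; rewrite /u matrix_U_term (negPf jk) mul0r add0r.
have uk c : u c k 0 = term_eval (ct i0 c) (row k x).
  by rewrite /u matrix_U_term eqxx mul1r.
have [t t0 tsmall] : exists2 t, 0 < t & forall c,
    (forall j, 0 <= u c j 0) \/ (forall j : 'I_l, (j < k)%N -> u c j 0 = 0) /\
      t * \sum_j `|u c j 0| <= u c k 0.
  apply: eventually_small_ex; apply: eventually_small_forall => c.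
  have [pos|[u0 upos]] := xpos c; first by exists 1 => // t _ _; left.
  have := eventually_small_affine (- \sum_j `|u c j 0|) upos.
  apply: eventually_smallW => t t0; rewrite mulrN addrC subr_gt0 => /ltW tu.
  by right.
(* Nonnegative multiples of the rows before [k] and small nonnegative multiples
   of the rows after [k] may be added to row [k] without leaving the polyhedron. *)
have term_ge0 c (s : 'I_l -> R) : (forall j, 0 <= s j) ->
    (forall j : 'I_l, (k < j)%N -> s j <= t) ->
    0 <= u c k 0 + \sum_(j | j != k) s j * u c j 0.
  move=> s0 st; have [upos|[u0 tu]] := tsmall c.
    by rewrite addr_ge0// sumr_ge0// => j _; exact: mulr_ge0.
  suff : - (\sum_(j | j != k) s j * u c j 0) <= u c k 0 by rewrite -subr_ge0 opprK.
  apply: le_trans tu; rewrite -sumrN mulr_sumr [leRHS](bigD1 k)//=.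
  rewrite -[leLHS]add0r; apply: lerD; first by rewrite mulr_ge0 // ltW.
  apply: ler_sum => j jk; have [jlt|kj|/val_inj/eqP] := ltngtP j k.
  - by rewrite u0// mulr0 oppr0 normr0 mulr0.
  - rewrite -mulrN; apply: (@le_trans _ _ (s j * `|u c j 0|)).
      by apply: ler_wpM2l => //; rewrite -normrN ler_norm.
    by apply: ler_wpM2r => //; exact: st.
  - by rewrite (negPf jk).
have xfree : row_free (row' k x).
  apply: first_nonzero_row_free => i; have [g [gi g0]] := xrows (lift k i).
  have xg h : (row' k x *m exp_col R g.2) h 0 = (matrix_U x k *m term_col g) (lift k h) 0.
    rewrite matrix_U_term eq_sym (negPf (neq_lift k h)) mul0r add0r dot_expE -row_mul.
    by rewrite !mxE; apply: eq_bigr => j _; rewrite !mxE.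
  exists (exp_col R g.2); split=> [|j ji]; first by rewrite xg.
  by rewrite xg g0//= ltnNge leq_bump2 -ltnNge.
have Qk : polyhedral_set (Q i0) (row k x).
  apply/ctQ => c; rewrite -uk; have := term_ge0 c (fun=> 0).
  rewrite big1 ?addr0 => [|j _]; last by rewrite mul0r.
  by apply=> // j _; exact: ltW.
exists x, k; split=> //.
  suff : (l.-1 <= d)%N by case: (l).
  apply: leq_trans (leq_bigmax i0); apply: (affine_dim_ge Qk xfree) => i.
  exists t; first by rewrite gt_eqF.
  apply/ctQ => c; rewrite /term_eval dot_exp_addr addrA -/(term_eval _ _) -uk dot_exp_scaler.
  have -> : row i (row' k x) = row (lift k i) x by apply/rowP => j; rewrite !mxE.
  have lk : lift k i != k by rewrite eq_sym neq_lift.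
  have := term_ge0 c (fun j => if j == lift k i then t else 0).
  rewrite (bigD1 (lift k i))//= eqxx big1 ?addr0 => [|j /andP[_ /negPf->]]; last by rewrite mul0r.
  by rewrite (udot _ _ lk); apply=> [j|j _]; case: ifP => // _; exact: ltW.
pose eps (i : 'I_l) : R := if (i < k)%N then 1 else t.
have eps0 i : 0 < eps i by rewrite /eps; case: ifP.
exists eps, (row k x); split=> //.
  exists (row k x) => //; exists 0; rewrite ?addr0//.
  by exists (fun=> 0); split=> //; rewrite big1// => j _; rewrite scale0r.
move=> _ [_ [delta delta_eps <-] [_ [a [a0 ->]] <-]]; exists i0 => //; apply/ctQ => c.
(* Flag vectors overlap: the coefficient of row [j] collects the coefficients of
   all flag vectors that reach it. *)
pose s (j : 'I_l) := if (j < k)%N then (\sum_(h < k | (j <= h)%N) a h) * flag_coef eps j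
  else if (k < j)%N then delta j else 0.
have s0 j : 0 <= s j.
  rewrite /s; case: ltngtP => // [jk|kj].
    rewrite mulr_ge0 ?sumr_ge0// /flag_coef; case: ifP => // _; exact: ltW.
  by have /andP[] := delta_eps j kj.
have st (j : 'I_l) : (k < j)%N -> s j <= t.
  move=> kj; rewrite /s ltnNge (ltnW kj) /= kj.
  by have /andP[_] := delta_eps j kj; rewrite /eps ltnNge (ltnW kj).
suff -> : term_eval (ct i0 c) (row k x + \sum_(i < l | (k < i)%N) delta i *: row i x +
    \sum_i a i *: flag_vector x eps i) = u c k 0 + \sum_(j | j != k) s j * u c j 0.
  exact: term_ge0.
rewrite /term_eval !dot_exp_addr 2!addrA -/(term_eval (ct i0 c) (row k x)) -uk -addrA; congr (_ + _).
rewrite [RHS](bigID (fun j : 'I_l => (j < k)%N)) [RHS]addrC /=; congr (_ + _).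
  rewrite dot_exp_sumr; apply: eq_big => j.
    by rewrite -leqNgt ltn_neqAle eq_sym.
  move=> kj; rewrite dot_exp_scaler /s ltnNge (ltnW kj) /= kj udot//.
  by rewrite -val_eqE (gtn_eqF kj).
rewrite dot_exp_sumr.
under [LHS]eq_bigr => h _ do rewrite dot_exp_scaler flag_vectorE dot_exp_sumr mulr_sumr.
rewrite (exchange_big_dep (fun i : 'I_l => (i < k)%N)) /=; last first.
  by move=> h i _ ih; exact: leq_ltn_trans ih (ltn_ord h).
apply: eq_big => i; first by rewrite andbC; case: ltnP => //= ik; rewrite -val_eqE (ltn_eqF ik).
move=> ik; rewrite /s ik udot; last by rewrite -val_eqE (ltn_eqF ik).
rewrite -mulrA mulr_suml; apply: eq_bigr => h _.
by rewrite dot_exp_scaler.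
Qed.

Lemma nonneg_spread l (U : 'M[R]_(l, 1 + n)) (keep : pred 'I_l) :
  (forall c, zero_or_first_pos (U *m term_col (ct i0 c))) ->
  exists t, forall c, let u := spread_matrix keep t *m U *m term_col (ct i0 c) in
    (forall j, 0 <= u j 0) \/
    exists2 i, ~~ keep i & (forall j : 'I_l, (j < i)%N -> u j 0 = 0) /\ 0 < u i 0.
Proof.
move=> Upos; have [t _ tpos] := eventually_small_ex
  (eventually_small_forall (fun c => spread_matrix_nonneg keep (Upos c))).
by exists t => c; rewrite /= -mulmxA; exact: tpos.
Qed.

(** When the first column has a pivot in row [k], this row is not used as a
    source in the spreading step, for it would spoil the zeros of the first
    column. *)
Lemma nonneg_cases l (U : 'M[R]_(l, 1 + n)) :
  (0 < l)%N -> zero_or_first_pos (lsubmx U) ->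
  (forall i, exists g, first_nonzero_at (U *m term_col g) i) ->
  (forall c, zero_or_first_pos (U *m term_col (ct i0 c))) ->
  exists W : 'M[R]_(l, 1 + n),
    [/\ (forall g, triangular_change (U *m term_col g) (W *m term_col g)),
        t_admissible W & case1 recV d W \/ case2 V d W].
Proof.
move=> l0 U1 Urows Upos.
have rows_change W (UW : forall g, triangular_change (U *m term_col g) (W *m term_col g)) i :
    exists g, first_nonzero_at (W *m term_col g) i.
  by have [g gi] := Urows i; exists g; have [] := triangular_first_nonzero (UW g) gi.
have admissible W (UW : forall g, triangular_change (U *m term_col g) (W *m term_col g)) :
    zero_or_first_pos (lsubmx W) -> t_admissible W.
  move=> W1; right; split=> //; last first.
    by move=> i; have [g gi] := rows_change W UW i; exists g.1, g.2.
  rewrite l0 /=; have /eqP <- : row_free W; last exact: rank_leq_col.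
  by apply: first_nonzero_row_free => i; have [g gi] := rows_change W UW i; exists (term_col g).
case: U1 => [U0|[k [Uk Uk0]]].
- have [t tpos] := nonneg_spread predT Upos.
  pose y := spread_matrix predT t *m rsubmx U.
  have yE : matrix_Z y = spread_matrix predT t *m U.
    by rewrite -[in RHS](hsubmxK U) U0 mul_mx_row mulmx0.
  have UW g : triangular_change (U *m term_col g) (matrix_Z y *m term_col g).
    by rewrite yE -mulmxA; exact: spread_matrix_change.
  exists (matrix_Z y); split=> //.
    by apply: admissible => //; left; rewrite row_mxKl.
  left; apply: nonneg_case1 => //; first exact: rows_change.
  by move=> c j; rewrite yE; have [|[]] := tpos c.
- pose L1 := pivot_matrix (lsubmx U) k.
  have U1pos c : zero_or_first_pos (L1 *m U *m term_col (ct i0 c)).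
    rewrite -mulmxA; have := Upos c.
    by move/(triangular_zero_or_first_pos (@pivot_matrix_change _ (lsubmx U) k _ Uk0)).
  have [t tpos] := nonneg_spread (predC1 k) U1pos.
  pose x := spread_matrix (predC1 k) t *m rsubmx (L1 *m U).
  have xE : matrix_U x k = spread_matrix (predC1 k) t *m (L1 *m U).
    rewrite -[in RHS](hsubmxK (L1 *m U)) mul_mx_row -mulmx_lsub pivot_matrixE//.
    congr row_mx; apply/colP => i; rewrite mxE [RHS]mxE (bigD1 k)//= big1 ?addr0 => [|j jk].
      rewrite !mxE !eqxx /= mulr1 eq_sym; case: eqP => // _.
      by rewrite eqxx andbF.
    by rewrite !mxE (negPf jk) mulr0.
  have UW g : triangular_change (U *m term_col g) (matrix_U x k *m term_col g).
    rewrite xE -!mulmxA => j v0.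
    have [c c0 vc] := @pivot_matrix_change _ (lsubmx U) k _ Uk0 j v0.
    have [|c' c'0 ->] := @spread_matrix_change _ (predC1 k) t (L1 *m (U *m term_col g)) j.
      move=> i ij; have [h hi|b _ ->] := @pivot_matrix_change _ (lsubmx U) k (U *m term_col g) Uk0 i.
        by apply: v0; exact: ltn_trans ij.
      by rewrite v0// mulr0.
    by exists (c' * c); [exact: mulr_gt0 | rewrite vc mulrA].
  exists (matrix_U x k); split=> //.
    apply: admissible => //; right; exists k; rewrite row_mxKl /first_nonzero_at !mxE !eqxx.
    by split=> //; split; rewrite ?oner_neq0// => j jk; rewrite mxE -val_eqE (ltn_eqF jk).
  right; apply: nonneg_case2 => //; first exact: rows_change.
  move=> c; have := tpos c; rewrite xE /=.
  by case=> [|[i /negPn/eqP->]]; [left | right].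
Qed.

End OrderCases.

End RealisedCases.

(** * The classification *)

(** A nonnegative constant absorbs [1] by taking the maximum.  For [a = 1] this
    makes the first column of a matrix representing the order zero or
    lexicographically positive. *)
Lemma prime_nonneg_const (R : realType) (n : nat) (C : set (laurent R n * laurent R n)) a :
  prime_congruence C -> 0 <= a -> prime_nonneg C (a, 0).
Proof.
move=> [[Crefl _ _ _ _] _ _] a0; rewrite /prime_nonneg /=.
suff -> : mon ((a, 0) : term R n) + 1 = mon (a, 0) by exact: Crefl.
rewrite -mon0; apply: gs_ext => m; rewrite -[LHS]/(gs_coef (gs_add _ _) m) gs_addE !mon_coef /=.
by case: eqP => // _; rewrite /GRing.add /= max_l.
Qed.

Lemma lsubmx_term_col (R : realType) (n l : nat) (U : 'M[R]_(l, 1 + n)) :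
  U *m term_col ((1, 0) : term R n) = lsubmx U.
Proof.
rewrite -[U in LHS]hsubmxK /term_col mul_row_col mulmx1.
suff -> : (map_mx intr (0 : 'rV[int]_n))^T = 0 :> 'cV[R]_n by rewrite mulmx0 addr0.
by apply/colP => i; rewrite !mxE.
Qed.

Lemma case0_realised (R : realType) (n : nat) (V : set 'rV[R]_n) l (U : 'M[R]_(l, 1 + n)) :
  case0 U -> positives_realised V (matrix_nonneg U).
Proof.
move=> [_ ->] [|g s] // _ spos; case: (spos g (mem_head _ _)).
by rewrite /matrix_nonneg /= mul0mx; left.
Qed.

Theorem theorem4p1 (R : realType) (n N : nat)
    (Q : 'I_N -> rational_polyhedron R n) (V recV : set 'rV[R]_n) (d : nat)
    (N_gt0 : (0 < N)%N)
    (Q_neq0 : forall i, polyhedral_set (Q i) !=set0)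
    (V_def : V = \bigcup_i polyhedral_set (Q i))
    (recV_def : recV = \bigcup_i recession_cone (Q i))
    (d_def : d = (\max_(i < N) affine_dim (polyhedral_set (Q i)))%N)
    (k : function_semiring)
    (P : set (fs_semiring R n k * fs_semiring R n k))
    (P_prime : prime_congruence P) :
  congruence_E V `<=` P <->
  exists (l : nat) (U : 'M[R]_(l, 1 + n)),
    [/\ t_admissible U,
        is_congruence_P U P &
        [\/ case0 U, case1 recV d U | case2 V d U]].
Proof.
have [P_cong _ _] := P_prime.
have C_prime := fs_map_prime P_prime.
apply: iff_trans (congruence_E_sub V P_cong) _; rewrite /is_congruence_P.
move: (pullback_congruence _ P) C_prime => C C_prime.
split=> [VC|[l [U [_ -> cases]]]].
- have real := agreement_realised C_prime VC.
  have [gs gs0 gspos|l [U [UN Urows]]] := @lex_representation R _ (term R n) (@term_col R n)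
      (prime_nonneg C) (prime_nonneg_total C_prime) (@prime_nonnegD _ _ _ C_prime).
    have [p _ ppos] := real gs gs0 gspos.
    by exists (row_mx 1%:M p) => g /ppos; rewrite term_eval_row.
  have [l0|l_gt0] := posnP l.
    exists 1%N, 0; split; [by left | | by apply: Or31].
    apply: prime_congruence_PE => // g; rewrite UN /matrix_nonneg /= mul0mx.
    split=> _; left => //; apply/colP => i.
    by have := ltn_ord i; rewrite [X in (_ < X)%N]l0.
  pose ct i := projT1 (cid (polyhedron_terms (Q i))).
  have ctQ i : (forall p, polyhedral_set (Q i) p <-> forall c, 0 <= term_eval (ct i c) p) /\
      (forall q, recession_cone (Q i) q <-> forall c, 0 <= dot_exp (ct i c).2 q).
    exact: (projT2 (cid (polyhedron_terms (Q i)))).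
  have [i p /(proj1 (ctQ i) p)||i0 ct_pos] := @realised_polyhedron _ _ N Q (prime_nonneg C) ct N_gt0.
  + by [].
  + by rewrite -V_def.
  have U1 : zero_or_first_pos (lsubmx U).
    by rewrite -lsubmx_term_col -UN; apply: prime_nonneg_const.
  have [|W [UW Wadm cases]] := @nonneg_cases _ _ _ Q ct i0 Q_neq0 (fun i => proj1 (ctQ i))
    (fun i => proj2 (ctQ i)) l U l_gt0 U1 Urows.
    by move=> c; rewrite -UN.
  exists l, W; split=> //.
    apply: prime_congruence_PE => // g; apply: iff_trans (UN g) _.
    by apply: triangular_zero_or_first_pos; exact: UW.
  by rewrite V_def recV_def d_def; case: cases; [apply: Or32 | apply: Or33].
- apply: realised_agreement.
    by have [p Qp] := Q_neq0 (Ordinal N_gt0); exists p; rewrite V_def; exists (Ordinal N_gt0).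
  case: cases => [|c1|]; [exact: case0_realised | | exact: case2_realised].
  by rewrite V_def; apply: case1_realised Q_neq0 _; rewrite -recV_def; exact: c1.
Qed.
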